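(* Let $L=\mathbb{Q}(\sqrt{3})$ with ring of integers $\mathcal{O}_L$, and let $|q|<1$. Define \[ L_{5}(q) := q \sum_{n \geq 1} \sum_{k=1}^{n} \frac{(-1)_n (q)_{n-1}(-1)^{n+k}q^{n+k^2-k} }{(q)_{n-k} (q^2; q^2)_{k-1} (1-q^{2k-1})},\qquad L_{6}(q) := \sum_{n \geq 1} \sum_{k=1}^{n} \frac{(-1)_n (q)_{n-1} (-1)^{n+k}q^{n+k^2} }{(q)_{n-k} (q^2;q^2)_{k-1}(1-q^{2k-1})}, \] \[ L_{7}(q) := 2 {\sum_{n \geq 0}}^{*}\sum_{k=0}^{n} \frac{(q^2; q^2)_{n}(-1)^{n+k} q^{k^2 + k}}{(q)_{n-k}(q^2;q^2)_k(1-q^{2k+1})},\qquad L_{8}(q) := -1 + 2 {\sum_{n \geq 0}}^{*}\sum_{k=0}^{n} \frac{(q^2; q^2)_{n}(-1)^{n+k} q^{k^2} }{(q)_{n-k} (q^2; q^2)_k (1-q^{2k+1})}. \] Then \[ q^{-2} L_{5}(q^{2}) = 2\sum_{\substack{\mathfrak{a} \subset \mathcal{O}_{L},\ N(\mathfrak{a}) \equiv 0 \pmod{2} \\ \mathfrak{a} = (x),\ N(x) < 0}} q^{N(\mathfrak{a})},\qquad q^{-1} L_{6}(q^{2}) = 2\sum_{\substack{\mathfrak{a} \subset \mathcal{O}_{L},\ N(\mathfrak{a}) \equiv 1 \pmod{2} \\ \mathfrak{a} = (x),\ N(x) < 0}} q^{N(\mathfrak{a})}, \] \[ qL_{7}(q^{6})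 = \sum_{\substack{\mathfrak{a} \subset \mathcal{O}_{L} \\ N(\mathfrak{a}) \equiv 1 \pmod{6}}} q^{N(\mathfrak{a})},\qquad q^{-2} L_{8}(q^{6}) = \sum_{\substack{\mathfrak{a} \subset \mathcal{O}_{L} \\ N(\mathfrak{a}) \equiv 4 \pmod{6}}} q^{N(\mathfrak{a})}. \]
   Context: For $n\in\mathbb{N}\cup\{\infty\}$, $(a)_n=(a;q)_n=\prod_{k=1}^{n}(1-aq^{k-1})$ (empty product $=1$), and $(a;q^2)_n$ is defined likewise with $q$ replaced by $q^2$. The notation ${\sum_{n\ge 0}}^{*} c_n$ denotes the value defined as the average of the even and odd partial sums, i.e. $\lim_{N\to\infty}\frac12\left(\sum_{n=0}^{2N}c_n+\sum_{n=0}^{2N+1}c_n\right)$ (the series need not converge classically). The sums on the right run over nonzero ideals $\mathfrak{a}$ of $\mathcal{O}_L$ with absolute norm $N(\mathfrak{a})$ satisfying the stated conditions, each ideal counted once; the condition ''$\mathfrak{a}=(x)$, $N(x)<0$'' means $\mathfrak{a}$ is principal with a generator $x$ whose field norm $N(x)$ is negative. *)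

(* Defs.v *)
From mathcomp Require Import all_boot all_order all_algebra.
From mathcomp Require Import complex finmap.
From mathcomp Require Import all_classical all_reals all_analysis.
Set Implicit Arguments. Unset Strict Implicit. Unset Printing Implicit Defensive.
Import Order.TTheory GRing.Theory Num.Theory.
Import numFieldTopology.Exports numFieldNormedType.Exports.
Local Open Scope ring_scope.
Local Open Scope classical_set_scope.

(* The complex numbers, seen as a numClosedFieldType (so that the
   normed/topological structure of MathComp-Analysis applies). *)
Definition Cx (R : realType) : numClosedFieldType := R[i].

Definition qpoch (C : numClosedFieldType) (a q : C) (n : nat) : C :=
  \prod_(0 <= k < n) (1 - a * q ^+ k).

Definition L5_term (C : numClosedFieldType) (q : C) (n k : nat) : C :=
  qpoch (-1) q n * qpoch q q n.-1 * (-1) ^+ (n + k) * q ^+ (n + k ^ 2 - k)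
  / (qpoch q q (n - k) * qpoch (q ^+ 2) (q ^+ 2) k.-1 * (1 - q ^+ (2 * k - 1))).

Definition L5_partial (C : numClosedFieldType) (q : C) (N : nat) : C :=
  q * \sum_(1 <= n < N.+1) \sum_(1 <= k < n.+1) L5_term q n k.

Definition L6_term (C : numClosedFieldType) (q : C) (n k : nat) : C :=
  qpoch (-1) q n * qpoch q q n.-1 * (-1) ^+ (n + k) * q ^+ (n + k ^ 2)
  / (qpoch q q (n - k) * qpoch (q ^+ 2) (q ^+ 2) k.-1 * (1 - q ^+ (2 * k - 1))).

Definition L6_partial (C : numClosedFieldType) (q : C) (N : nat) : C :=
  \sum_(1 <= n < N.+1) \sum_(1 <= k < n.+1) L6_term q n k.

Definition L7_inner (C : numClosedFieldType) (q : C) (n : nat) : C :=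
  \sum_(0 <= k < n.+1)
    qpoch (q ^+ 2) (q ^+ 2) n * (-1) ^+ (n + k) * q ^+ (k ^ 2 + k)
    / (qpoch q q (n - k) * qpoch (q ^+ 2) (q ^+ 2) k * (1 - q ^+ (2 * k + 1))).

Definition L8_inner (C : numClosedFieldType) (q : C) (n : nat) : C :=
  \sum_(0 <= k < n.+1)
    qpoch (q ^+ 2) (q ^+ 2) n * (-1) ^+ (n + k) * q ^+ (k ^ 2)
    / (qpoch q q (n - k) * qpoch (q ^+ 2) (q ^+ 2) k * (1 - q ^+ (2 * k + 1))).

(* The "starred" sum: the sequence N |-> (1/2) (sum_{n=0}^{2N} c_n + sum_{n=0}^{2N+1} c_n),
   whose limit is by definition  sum*_{n>=0} c_n . *)
Definition star_partial (C : numClosedFieldType) (c : nat -> C) (N : nat) : C :=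
  2^-1 * (\sum_(0 <= n < (2 * N).+1) c n + \sum_(0 <= n < (2 * N + 1).+1) c n).

Definition L7_partial (C : numClosedFieldType) (q : C) (N : nat) : C :=
  2 * star_partial (L7_inner q) N.

Definition L8_partial (C : numClosedFieldType) (q : C) (N : nat) : C :=
  -1 + 2 * star_partial (L8_inner q) N.

(* O_L = Z[sqrt 3]; the pair (a, b) stands for a + b sqrt 3. *)
Definition OL := (int * int)%type.

Definition OL_sub (x y : OL) : OL := (x.1 - y.1, x.2 - y.2).
Definition OL_mul (x y : OL) : OL :=
  (x.1 * y.1 + 3 * x.2 * y.2, x.1 * y.2 + x.2 * y.1).

Definition OL_fnorm (x : OL) : int := x.1 ^+ 2 - 3 * x.2 ^+ 2.

Definition nonzero_ideal (I : set OL) : Prop :=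
  [/\ I (0, 0),
      (forall x y, I x -> I y -> I (OL_sub x y)),
      (forall r x, I x -> I (OL_mul r x)) &
      exists x, I x /\ x <> (0, 0)].

(* absolute norm: N(I) = n iff the quotient O_L / I has exactly n elements,
   i.e. there are n representatives r_0, ..., r_{n-1} such that every x is
   congruent mod I to exactly one of them. *)
Definition ideal_norm_is (I : set OL) (n : nat) : Prop :=
  exists r : 'I_n -> OL, forall x, exists! i, I (OL_sub x (r i)).

Definition principal_neg (I : set OL) : Prop :=
  exists x : OL, (forall y, I y <-> exists r, y = OL_mul r x) /\ OL_fnorm x < 0.

Definition ideal_count (P : set OL -> Prop) (n : nat) : nat :=
  #|` fset_set [set I : set OL | nonzero_ideal I /\ ideal_norm_is I n /\ P I] |%fset.

Definition ideal_series_partial (C : numClosedFieldType) (P : set OL -> Prop)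
    (m r : nat) (q : C) (N : nat) : C :=
  \sum_(0 <= n < N) (if (n %% m)%N == r then (ideal_count P n)%:R * q ^+ n else 0).

(* Main.v *)
Require Import Defs.
From mathcomp Require Import all_boot all_order all_algebra.
From mathcomp Require Import complex finmap ring lra zify.
From mathcomp Require Import all_classical all_reals all_analysis.
Import Order.TTheory GRing.Theory Num.Theory.
Import numFieldTopology.Exports numFieldNormedType.Exports.
Local Open Scope ring_scope.
Local Open Scope classical_set_scope.

(** The inner sums are half of a Bailey pair: inverting the Bailey lattice (Gauss'
    sum plus an Abel summation) writes 1 / ((Q^2; Q^2)_k (1 - Q^(2k+1))) as an
    alternating sum whose coefficients are the finite indefinite theta functions
    theta_r = sum_i Q^(2 i (r - i)) w^(r - 2 i).  The q-Vandermonde sum then turns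
    the N-th partial sum of each L_j into sum_r (+-) theta_r Q^(...) c_r(N), and the
    factors c_r(N) satisfy a first-order recurrence in r that makes them converge
    geometrically fast to a monomial.  The limits are indefinite theta series of
    the form sum q^|a^2 - 3 b^2|.

    On the other side Z[sqrt 3] is Euclidean, so every ideal is principal, and the
    powers of the unit 2 + sqrt 3 leave exactly one generator of negative norm in
    the cone 0 < b, -b <= a < b; generators of positive norm prime to 3 are reduced
    to this case by multiplying with sqrt 3.  Matching exponents termwise
    identifies the two series. *)

(** * q-series identities *)

(** The shape of [theta] comes from the denominators 1 - Q^(2k+1). For a_b = 1 / ((Q)_(k-b)
    (Q)_(k+b)) the combination a_b - Q^(2b+2) a_(b+2) equals (1 - Q^(2b+2)) (1 - Q^(2k+1)) /
    ((Q)_(k-b) (Q)_(k+b+2)), and [theta] solves the two-step recurrence with exactly the weight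
    Q^(2b+2). The resulting expansion is used relative to Q^2 for L_5 and L_6, whose exponents
    contain k^2 + 2k after a shift, and is rewritten relative to Q for L_7 and L_8, whose exponents
    contain k^2 + k. For L_7 and L_8 the coefficient sums over n do not converge: they keep an
    alternating term whose modulus has a nonzero limit. In the average of two consecutive partial
    sums this term enters only through a difference of consecutive values, which is geometrically
    small. For L_8, theta series and lattice points do not match row by row: row r is off by
    Q^((r+1)^2) - Q^(r^2). These defects telescope and produce the constant -1 of L_8. *)

Ltac nonzero_from h :=
  match type of h with is_true (?a != 0) =>
    match goal with |- is_true (?b != 0) =>
      have -> : b = a by ring end end; exact h.

(** [field] leaves its side conditions in its own normal form; [ring] recognises each of them as one
    of the two given nonvanishing facts. *)
Ltac split_nonzero h1 h2 :=
  repeat (apply/andP; split); first [done | nonzero_from h1 | nonzero_from h2].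

Lemma qpochS (C : numClosedFieldType) (a q : C) n :
  qpoch a q n.+1 = qpoch a q n * (1 - a * q ^+ n).
Proof. by rewrite /qpoch big_nat_recr. Qed.

Lemma qpoch0 (C : numClosedFieldType) (a q : C) : qpoch a q 0 = 1.
Proof. by rewrite /qpoch big_nil. Qed.

Section BaileyPairs.
Variables (C : numClosedFieldType) (Q : C).
Hypothesis Q_neq0 : Q != 0.
Hypothesis Q_nroot : forall n, 1 - Q ^+ n.+1 != 0.

Let P n : C := qpoch Q Q n.
Let P2 n : C := qpoch (Q ^+ 2) (Q ^+ 2) n.
Let D n : C := qpoch (-1) Q n.

Let PS n : P n.+1 = P n * (1 - Q ^+ n.+1).
Proof. by rewrite /P qpochS exprS. Qed.

Let P2S n : P2 n.+1 = P2 n * (1 - Q ^+ n.+1 * Q ^+ n.+1).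
Proof. by rewrite /P2 qpochS -exprS -exprM mulnC exprM expr2. Qed.

Let DS n : D n.+1 = D n * (1 + Q ^+ n).
Proof. by rewrite /D qpochS mulN1r opprK. Qed.

Let P_neq0 n : P n != 0.
Proof.
elim: n => [|n IH]; first by rewrite /P qpoch0 oner_neq0.
by rewrite PS mulf_neq0.
Qed.

Let P2_neq0 n : P2 n != 0.
Proof.
elim: n => [|n IH]; first by rewrite /P2 qpoch0 oner_neq0.
by rewrite P2S mulf_neq0 // -exprD addSn Q_nroot.
Qed.

(* [1 / (Q)_(k - r)], read as 0 when [k < r]. *)
Definition rinv k r : C := if (r <= k)%N then (P (k - r))^-1 else 0.

Lemma rinv_add d r : rinv (d + r) r = (P d)^-1.
Proof. by rewrite /rinv leq_addl addnK. Qed.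

Lemma rinv_gt k r : (k < r)%N -> rinv k r = 0.
Proof. by rewrite /rinv ltnNge => /negbTE ->. Qed.

Lemma rinvSS k r : rinv k.+1 r.+1 = rinv k r.
Proof. by rewrite /rinv ltnS subSS. Qed.

Lemma rinv_succ d r : rinv (d + r) r = (1 - Q ^+ d.+1) * rinv (d + r).+1 r.
Proof.
rewrite -addSn !rinv_add PS; field; by rewrite P_neq0 Q_nroot.
Qed.

Lemma rinv_succr d r : rinv (d + r) r.+1 = (1 - Q ^+ d) * rinv (d + r) r.
Proof.
case: d => [|d]; first by rewrite rinv_gt // expr0 subrr mul0r.
by rewrite addSnnS rinv_succ rinvSS.
Qed.

(** Up to constant factors, [ubase] and [ebase] are the kernels of Bailey pairs relative to Q and to
    1, multiplied by (Q^2; Q^2)_n. *)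
Definition ubase n r : C := P2 n * rinv n r / P (n + r).+1.
Definition ebase n r : C := P2 n * rinv n r / P (n + r).

Lemma ubase_gt n r : (n < r)%N -> ubase n r = 0.
Proof. by move=> h; rewrite /ubase rinv_gt // mulr0 mul0r. Qed.

Lemma ebase_gt n r : (n < r)%N -> ebase n r = 0.
Proof. by move=> h; rewrite /ebase rinv_gt // mulr0 mul0r. Qed.

(** Weighted by (-1)^n the left side telescopes in n, so alternating sums of [ubase] collapse to a
    single [ebase]. *)
Lemma ebase_rec n r :
  ebase n.+1 r.+1 + ebase n r.+1 = ubase n r + ubase n r.+1.
Proof.
rewrite /ebase /ubase; case: (leqP r n) => [h|h]; last first.
  by rewrite rinvSS (rinv_gt n r) // (rinv_gt n r.+1) ?ltnS 1?ltnW // !(mulr0, mul0r).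
rewrite -(subnK h); move: (n - r)%N => d.
rewrite rinvSS rinv_succr !addnS !addSn !PS P2S.
have ha := P_neq0 (d + r + r); have h1 := Q_nroot (d + r + r).
have h2 := Q_nroot (d + r + r).+1.
move: (rinv _ _) (P2 _) (P _) ha h1 h2 => X p a ha.
rewrite !exprS !exprD => h1 h2; field.
by split_nonzero h1 h2.
Qed.

Lemma ebase_rec0 n : ebase n.+1 0 + ebase n 0 = 2 * ubase n 0.
Proof.
rewrite /ebase /ubase -(addn0 n) rinv_succ !addn0 !PS P2S.
have ha := P_neq0 n; have h1 := Q_nroot n.
move: (rinv _ _) (P2 _) (P _) ha h1 => X p a ha.
rewrite !exprS => h1; field.
by split_nonzero h1 h1.
Qed.

(** Meant as a size estimate: the last factor is of order Q^(n+1-b), so [ebase] is nearly constant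
    in n. *)
Lemma ebase_sub n b : (b <= n.+1)%N ->
  ebase n.+1 b - ebase n b = P2 n * rinv n.+1 b / P (n.+1 + b)
    * (Q ^+ (n.+1 - b) + Q ^+ (n.+1 + b) - 2 * Q ^+ n.+1 * Q ^+ n.+1).
Proof.
move=> hb; rewrite /ebase.
have -> : rinv n b = (1 - Q ^+ (n.+1 - b)) * rinv n.+1 b.
  move: hb; rewrite leq_eqVlt => /orP[/eqP ->|]; first by rewrite subnn subrr mul0r rinv_gt.
  by rewrite ltnS => h; have := rinv_succ (n - b) b; rewrite subnK // subSn.
rewrite addSn PS P2S.
have e1 : Q ^+ n.+1 = Q ^+ (n.+1 - b) * Q ^+ b by rewrite -exprD subnK.
have e2 : Q ^+ (n + b).+1 = Q ^+ (n.+1 - b) * Q ^+ b * Q ^+ b.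
  by rewrite -e1 -exprD addSn.
have ha := P_neq0 (n + b); have := Q_nroot (n + b).
rewrite e2 e1 => h1; move: (Q ^+ (n.+1 - b)) (Q ^+ b) h1 => y x h1.
by field; split_nonzero ha h1.
Qed.

Section BaileyPair.
(* The case [w = 1] serves L_6 and L_7, the case [w = Q] serves L_5 and L_8. *)
Variable w : C.
Hypothesis w_spec : w = 1 \/ w = Q.

Let w_neq0 : w != 0.
Proof. by case: w_spec => ->; rewrite ?oner_neq0. Qed.

(** The terms b and -b of a bilateral sum against an even kernel, folded together; b = 0 counts
    once. *)
Definition alpha b : C := if b is 0 then 1 else w ^+ b + w ^- b.
Arguments alpha : simpl never.

(* Telescoping certificate of Wilf-Zeilberger type for [sum_alpha_ebase]. *)
Definition gauss_cert n b : C := w ^+ b.+1 + w ^- b - (1 - w) * Q ^+ n.+1.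

Lemma gauss_cert_rec n b :
  (w * ebase n.+1 b.+1 + ebase n b.+1) * alpha b.+1
  = gauss_cert n b * ubase n b + gauss_cert n b.+1 * ubase n b.+1.
Proof.
rewrite /alpha /gauss_cert /ebase /ubase.
case: (leqP b n) => [h|h]; last first.
  by rewrite rinvSS (rinv_gt n b) // (rinv_gt n b.+1) ?ltnS 1?ltnW // !(mulr0, mul0r) !addr0 mul0r.
rewrite -(subnK h); move: (n - b)%N => d.
rewrite rinvSS rinv_succr !addnS !addSn !PS P2S.
have ha := P_neq0 (d + b + b); have h1 := Q_nroot (d + b + b).
have h2 := Q_nroot (d + b + b).+1.
move: (rinv _ _) (P2 _) (P _) ha h1 h2 => X p a ha.
rewrite !exprS !exprD.
case: w_spec => ->.
  rewrite !expr1n => h1 h2; field.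
  by split_nonzero h1 h2.
have := expf_neq0 b Q_neq0 => hb h1 h2; field.
by split_nonzero h1 h2.
Qed.

Lemma gauss_cert_rec0 n :
  w * ebase n.+1 0 + ebase n 0 = gauss_cert n 0 * ubase n 0.
Proof.
rewrite /gauss_cert /ebase /ubase -(addn0 n) rinv_succ !addn0 !PS P2S.
have ha := P_neq0 n; have h1 := Q_nroot n.
move: (rinv _ _) (P2 _) (P _) ha h1 => X p a ha.
rewrite !expr0 !exprS => h1; case: w_spec => ->; field.
  by split_nonzero h1 h1.
by split_nonzero h1 h1.
Qed.

(** If S_n is the left side, the certificate gives w S_(n+1) + S_n = 0, its boundary term vanishing
    with [ubase n n.+1]. For w = 1 this is Gauss' alternating sum of the q-binomial coefficients of
    order 2n. *)
Lemma sum_alpha_ebase n :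
  \sum_(b < n.+1) (-1) ^+ b * alpha b * ebase n b = (-1) ^+ n * w ^- n.
Proof.
elim: n => [|n IH].
  by rewrite big_ord1 /ebase /rinv /= /P /P2 !qpoch0 !expr0 !invr1 !mulr1.
have tele m : \sum_(b < m.+1) (-1) ^+ b * alpha b * (w * ebase n.+1 b + ebase n b)
    = (-1) ^+ m * gauss_cert n m * ubase n m.
  elim: m => [|m IHm]; first by rewrite big_ord1 gauss_cert_rec0 /= !mul1r.
  rewrite big_ord_recr IHm /= -[X in _ + X]mulrA [X in _ + _ * X]mulrC gauss_cert_rec exprS.
  by ring.
have := tele n.+1.
rewrite ubase_gt // mulr0.
under eq_bigr => b _ do rewrite mulrDr.
rewrite big_split /= [X in _ + X]big_ord_recr /= IH.
rewrite (ebase_gt n n.+1) // mulr0 addr0.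
under eq_bigr => b _ do rewrite mulrCA.
rewrite -mulr_sumr => /eqP; rewrite addr_eq0 => /eqP h.
apply: (mulfI w_neq0); rewrite h !exprS.
by field; rewrite w_neq0 expf_neq0.
Qed.

(** The quadratic form is indefinite because 2 i (r - i) = (r^2 - (r - 2i)^2) / 2. *)
Definition theta r : C :=
  \sum_(i < r.+1) Q ^+ (2 * i * (r - i)) * w ^+ (r - i) * w ^- i.

Lemma theta0 : theta 0 = alpha 0.
Proof. by rewrite /theta big_ord1 !expr0 invr1 !mulr1. Qed.

Lemma theta1 : theta 1 = alpha 1.
Proof.
rewrite /theta big_ord_recr big_ord1 /= !expr0 !expr1 invr1 !mulr1.
by rewrite !mul1r /alpha !expr1.
Qed.

Lemma theta_rec r : theta r.+2 = alpha r.+2 + Q ^+ (2 * r + 2) * theta r.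
Proof.
rewrite /theta big_ord_recl big_ord_recr /= subnn !muln0 subn0 !expr0 !mul1r invr1 mulr1.
rewrite addrCA [RHS]addrAC -addrA addrC -addrA; congr (_ + _).
rewrite addrC; congr (_ + _); rewrite mulr_sumr; apply: eq_bigr => i _.
have hi : (i <= r)%N by rewrite -ltnS.
rewrite /bump /= add1n; move: hi; move: (nat_of_ord i) => j hj.
rewrite -{1 2 3 4}(subnK hj); move: (r - j)%N => d.
rewrite -addnS -addSn [in (d.+1 + j.+1 - j.+1)%N]addnK.
rewrite (_ : 2 * j.+1 * d.+1 = 2 * (d + j) + 2 + 2 * j * d)%N; last by lia.
by rewrite addnK exprD ![w ^+ _.+1]exprS; field; rewrite w_neq0 expf_neq0.
Qed.

(** Summation by parts with step two: [theta_rec] reads alpha_b = theta_b - Q^(2b-2) theta_(b-2),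
    and the last two indices remain as boundary terms. *)
Lemma abel_theta (a : nat -> C) m :
  \sum_(b < m.+2) (-1) ^+ b * alpha b * a b =
  \sum_(b < m) (-1) ^+ b * theta b * (a b - Q ^+ (2 * b + 2) * a b.+2)
  + (-1) ^+ m * theta m * a m + (-1) ^+ m.+1 * theta m.+1 * a m.+1.
Proof.
elim: m => [|m IH].
  by rewrite big_ord0 !big_ord_recr big_ord0 /= theta0 theta1.
rewrite big_ord_recr IH [in RHS]big_ord_recr /= theta_rec !exprS.
by ring.
Qed.

(** In [abel_theta] with a_b = 1 / ((Q)_(k-b) (Q)_(k+b)) and m = k + 1, both boundary terms vanish
    and each difference contains the factor 1 - Q^(2k+1), which is divided out. *)
Lemma sum_theta k :
  \sum_(r < k.+1) (-1) ^+ r * (1 - Q ^+ (2 * r + 2)) * theta r * rinv k r / P (k + r).+2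
  = (-1) ^+ k * w ^- k / (P2 k * (1 - Q ^+ (2 * k + 1))).
Proof.
have := abel_theta (fun b => rinv k b / P (k + b)) k.+1.
rewrite big_ord_recr /= (rinv_gt k k.+2) // (rinv_gt k k.+1) //.
rewrite big_ord_recr /= (rinv_gt k k.+1) // !mul0r !mulr0 !addr0.
have hP2 := P2_neq0 k.
have hk : 1 - Q ^+ (2 * k + 1) != 0 by rewrite addn1 Q_nroot.
have -> : \sum_(b < k.+1) (-1) ^+ b * alpha b * (rinv k b / P (k + b)) =
          (-1) ^+ k * w ^- k / P2 k.
  rewrite -sum_alpha_ebase mulr_suml; apply: eq_bigr => b _.
  have hb := P_neq0 (k + b); rewrite /ebase; field.
  by split_nonzero hb hP2.
move=> h; rewrite invfM mulrA h mulr_suml; apply: eq_bigr => r _.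
have hr : (r <= k)%N by rewrite -ltnS.
move: hk; move: (nat_of_ord r) hr => j hj hk.
rewrite -(subnK hj) in hk *; move: (k - j)%N hk => d hk.
have e2 : rinv (d + j) j.+2 = (1 - Q ^+ d) * (1 - Q ^+ d.-1) * rinv (d + j) j.
  case: d {hk h hP2 hj} => [|d]; first by rewrite rinv_gt // expr0 subrr !mul0r.
  rewrite {1}addSnnS rinv_succr addSnnS -addSnnS rinv_succr /=; ring.
rewrite e2 !addnS !PS.
have ha := P_neq0 (d + j + j); have h1 := Q_nroot (d + j + j).
have h2 := Q_nroot (d + j + j).+1.
move: (rinv _ _) (P _) ha h1 h2 => X a ha.
(* The truncated predecessor is traded for a division by Q; at d = 0 both sides vanish through 1 -
   Q^d. *)
have -> : (1 - Q ^+ d) * (1 - Q ^+ d.-1) * X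
  = (1 - Q ^+ d) * (1 - Q ^+ d / Q) * X.
  case: d {hk h hP2 hj e2} => [|d]; first by rewrite expr0 subrr !mul0r.
  by rewrite exprSr mulfK.
move: hk; rewrite !mulnDr !mul2n -!addnn !addn0 addn1 !exprS !exprD => hk h1 h2.
field.
by split_nonzero h1 h2.
Qed.

(** * The q-Vandermonde sum and the Bailey lemma *)

Lemma sum_vandermonde N s :
  \sum_(i < N.+1) Q ^+ (i * (i + s)) * rinv N i / (P i * P (i + s))
  = (P N * P (N + s))^-1.
Proof.
elim: N s => [|N IH] s.
  by rewrite big_ord1 mul0n expr0 /rinv /= !add0n /P qpoch0 invr1 !mul1r.
apply: (mulfI (Q_nroot N)).
have h1 := P_neq0 N; have h2 := P_neq0 (N + s); have h3 := Q_nroot N.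
have h4 := Q_nroot (N + s).
(* A Pascal-type recurrence for the right side; it mixes s and s + 1, so the induction on N runs
   over all s at once. *)
have -> : (1 - Q ^+ N.+1) * (P N.+1 * P (N.+1 + s))^-1
  = (P N * P (N + s))^-1 + Q ^+ (N.+1 + s) * (P N * P (N + s.+1))^-1.
  rewrite addnS addSn !PS; move: (P _) (P _) h1 h2 h3 h4 => a b h1 h2 h3 h4.
  by field; rewrite h1 h2 h3 h4.
rewrite -!IH mulr_sumr big_ord_recl [X in _ = X + _]big_ord_recl /=.
rewrite [X in _ + X = _](_ : _ =
  \sum_(i < N) Q ^+ (i.+1 * (i.+1 + s)) * rinv N i.+1 / (P i.+1 * P (i.+1 + s))
  + Q ^+ (N.+1 + s) *
    \sum_(i < N.+1) Q ^+ (i * (i + s.+1)) * rinv N i / (P i * P (i + s.+1))).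
  rewrite addrA; congr (_ + _ + _); rewrite !mul0n expr0 !mul1r mulrA.
  by have := rinv_succ N 0; rewrite addn0 => ->.
transitivity (\sum_(i < N.+1) (Q ^+ (i.+1 * (i.+1 + s)) * rinv N i.+1 / (P i.+1 * P (i.+1 + s))
   + Q ^+ (N.+1 + s) * (Q ^+ (i * (i + s.+1)) * rinv N i / (P i * P (i + s.+1))))).
  apply: eq_bigr => i _; rewrite /bump /= add1n rinvSS.
  have hi : (i <= N)%N by rewrite -ltnS.
  move: (nat_of_ord i) hi => j hj.
  rewrite (_ : rinv N j.+1 = (1 - Q ^+ (N - j)) * rinv N j); last first.
    by have := rinv_succr (N - j) j; rewrite subnK.
  have hN : Q ^+ N.+1 = Q * Q ^+ (N - j) * Q ^+ j.
    by rewrite -mulrA -exprD subnK // exprS.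
  rewrite (_ : j.+1 * (j.+1 + s) = j * (j + s.+1) + j.+1 + s)%N; last by lia.
  rewrite addSnnS PS !exprD hN.
  have h5 := P_neq0 j; have h6 := Q_nroot j; have h7 := P_neq0 (j + s.+1).
  move: (P j) (P _) h5 h7 => a b h5 h7.
  rewrite [Q ^+ j.+1]exprS in h6 *; field; split_nonzero h6 h6.
rewrite big_split /= -mulr_sumr; congr (_ + _).
by rewrite big_ord_recr /= rinv_gt // mulr0 mul0r addr0.
Qed.

(** The Bailey lemma relative to Q^s with both free parameters sent to infinity. The shift j = r + i
    reduces it to q-Vandermonde with 2r + s in place of s. *)
Lemma sum_bailey m r s : (r <= m)%N ->
  \sum_(j < m.+1) Q ^+ (j * (j + s)) * rinv m j * rinv j r / P (j + r + s)
  = Q ^+ (r * (r + s)) * rinv m r / P (m + r + s).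
Proof.
move=> h; rewrite -(subnK h); move: (m - r)%N => N {h m}.
rewrite [(N + r)%N]addnC -[(r + N).+1]addnS big_split_ord /= big1 ?add0r; last first.
  by move=> i _; rewrite (rinv_gt i r) // mulr0 mul0r.
rewrite {2}[(r + N)%N]addnC rinv_add -mulrA.
rewrite (_ : (r + N + r + s = N + (2 * r + s))%N); last by lia.
rewrite -invfM -sum_vandermonde mulr_sumr; apply: eq_bigr => i _.
rewrite (_ : ((r + i) * (r + i + s) = r * (r + s) + i * (i + (2 * r + s)))%N); last by lia.
rewrite (_ : (r + i + r + s = i + (2 * r + s))%N); last by lia.
have -> : rinv (r + i) r = (P i)^-1 by rewrite addnC rinv_add.
rewrite exprD.
have -> : rinv (r + N) (r + i) = rinv N i.
  by rewrite /rinv leq_add2l subnDl.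
by rewrite invfM; ring.
Qed.

Lemma rinvE m j : (j <= m)%N -> (P (m - j))^-1 = rinv m j.
Proof. by rewrite /rinv => ->. Qed.

Lemma sum_theta_le k m : (k <= m)%N ->
  \sum_(r < m.+1) (-1) ^+ r * (1 - Q ^+ (2 * r + 2)) * theta r * rinv k r / P (k + r).+2
  = (-1) ^+ k * w ^- k / (P2 k * (1 - Q ^+ (2 * k + 1))).
Proof.
move=> h; rewrite -(subnKC h) -addSn big_split_ord /= sum_theta big1 ?addr0 //.
by move=> i _; rewrite rinv_gt ?addSn ?ltnS ?leq_addr // mulr0 mul0r.
Qed.

Definition theta_shift r : C := if r is r'.+1 then Q ^+ (2 * r) * theta r' else 0.

(** The expansion of [sum_theta] moved from base Q^2 to base Q: each term splits between the rows r
    and r + 1. The truncations differ by one boundary term, which vanishes beyond row k. *)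
Lemma sum_theta_shift k m : (k <= m)%N ->
  \sum_(r < m.+1) (-1) ^+ r * (theta r + theta_shift r) * rinv k r / P (k + r).+1
  = (-1) ^+ k * w ^- k / (P2 k * (1 - Q ^+ (2 * k + 1))).
Proof.
move=> h; rewrite -(sum_theta_le k m h).
have tele K : \sum_(r < K) (-1) ^+ r * (theta r + theta_shift r) * rinv k r / P (k + r).+1
  = \sum_(r < K) (-1) ^+ r * (1 - Q ^+ (2 * r + 2)) * theta r * rinv k r / P (k + r).+2
    - (-1) ^+ K * theta_shift K * rinv k K / P (k + K).+1.
  elim: K => [|K IH]; first by rewrite !big_ord0 /= mulr0 !mul0r subr0.
  rewrite !big_ord_recr /= IH; case: (leqP K k) => hK; last first.
    by rewrite (rinv_gt k K) // (rinv_gt k K.+1) ?ltnS 1?ltnW //; ring.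
  have -> : rinv k K.+1 = (1 - Q ^+ (k - K)) * rinv k K.
    by have := rinv_succr (k - K) K; rewrite subnK.
  have e1 : Q ^+ (k + K).+2 = Q * Q * (Q ^+ (k - K) * Q ^+ K * Q ^+ K).
    by rewrite -!exprD subnK // -mulrA -!exprS.
  have e2 : Q ^+ (2 * K + 2) = Q * Q * (Q ^+ K * Q ^+ K).
    by rewrite -!exprD -mulrA -!exprS; congr (_ ^+ _); lia.
  have e3 : Q ^+ (2 * K.+1) = Q * Q * (Q ^+ K * Q ^+ K).
    by rewrite -e2; congr (_ ^+ _); lia.
  have ha := P_neq0 (k + K).+1; have := Q_nroot (k + K).+1.
  rewrite [(k + K.+1)%N]addnS (PS (k + K).+1) ?e2 ?e3 e1 [(-1) ^+ K.+1]exprS => h1.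
  by field; split_nonzero ha h1.
by rewrite tele rinv_gt // mulr0 mul0r subr0.
Qed.

Lemma sum_pair2 m :
  \sum_(j < m.+1) (-1) ^+ j * w ^- j * Q ^+ (j * (j + 2)) * rinv m j
      / (P2 j * (1 - Q ^+ (2 * j + 1)))
  = \sum_(r < m.+1) (-1) ^+ r * (1 - Q ^+ (2 * r + 2)) * theta r
      * (Q ^+ (r * (r + 2)) * rinv m r / P (m + r).+2).
Proof.
transitivity (\sum_(j < m.+1) Q ^+ (j * (j + 2)) * rinv m j *
  \sum_(r < m.+1) (-1) ^+ r * (1 - Q ^+ (2 * r + 2)) * theta r * rinv j r / P (j + r).+2).
  apply: eq_bigr => j _; rewrite sum_theta_le -1?ltnS //; ring.
under eq_bigr => j _ do rewrite mulr_sumr.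
rewrite exchange_big /=; apply: eq_bigr => r _; move: (theta r) => t.
rewrite -[(m + r).+2]addn2 -sum_bailey -1?ltnS // mulr_sumr.
by apply: eq_bigr => j _; rewrite [(j + r + 2)%N]addn2; ring.
Qed.

Lemma sum_pair1 m :
  \sum_(j < m.+1) (-1) ^+ j * w ^- j * Q ^+ (j * (j + 1)) * rinv m j
      / (P2 j * (1 - Q ^+ (2 * j + 1)))
  = \sum_(r < m.+1) (-1) ^+ r * (theta r + theta_shift r)
      * (Q ^+ (r * (r + 1)) * rinv m r / P (m + r).+1).
Proof.
transitivity (\sum_(j < m.+1) Q ^+ (j * (j + 1)) * rinv m j *
  \sum_(r < m.+1) (-1) ^+ r * (theta r + theta_shift r) * rinv j r / P (j + r).+1).
  by apply: eq_bigr => j _; rewrite sum_theta_shift -1?ltnS //; ring.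
under eq_bigr => j _ do rewrite mulr_sumr.
rewrite exchange_big /=; apply: eq_bigr => r _; move: (_ + theta_shift r) => t.
rewrite -[(m + r).+1]addn1 -sum_bailey -1?ltnS // mulr_sumr.
by apply: eq_bigr => j _; rewrite [(j + r + 1)%N]addn1; ring.
Qed.

(** * Partial sums of L_5 and L_6 *)

Definition kappa r N : C := (1 - Q ^+ (2 * r + 2)) *
  \sum_(m < N) D m.+1 * P m * (-1) ^+ m * Q ^+ m.+1 * rinv m r / P (m + r).+2.

Lemma double_sum_kappa N :
  \sum_(m < N) \sum_(j < m.+1) D m.+1 * P m * (-1) ^+ (m + j)
     * (Q ^+ (m.+1 + j.+1 ^ 2) * w ^- j)
     / (P (m - j) * P2 j * (1 - Q ^+ (2 * j + 1)))
  = \sum_(r < N) (-1) ^+ r * theta r * Q ^+ (r.+1 ^ 2) * kappa r N.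
Proof.
transitivity (\sum_(m < N) \sum_(r < N) (-1) ^+ r * theta r * Q ^+ (r.+1 ^ 2) *
   ((1 - Q ^+ (2 * r + 2)) * (D m.+1 * P m * (-1) ^+ m * Q ^+ m.+1 * rinv m r / P (m + r).+2))).
  apply: eq_bigr => -[m hm] _ /=.
  rewrite -[in RHS](subnKC hm) big_split_ord /= [X in _ + X]big1 ?addr0; last first.
    by move=> i _; rewrite (rinv_gt m (m.+1 + i)) ?addSn ?ltnS ?leq_addr // !(mulr0, mul0r).
  transitivity (D m.+1 * P m * (-1) ^+ m * Q ^+ m.+2 *
    \sum_(j < m.+1) (-1) ^+ j * w ^- j * Q ^+ (j * (j + 2)) * rinv m j
      / (P2 j * (1 - Q ^+ (2 * j + 1)))).
    rewrite mulr_sumr; apply: eq_bigr => j _; rewrite -rinvE -1?ltnS //.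
    (* The shift k = j + 1 turns the square into j (j + 2), the Bailey exponent relative to Q^2. *)
    rewrite (_ : m.+1 + j.+1 ^ 2 = m.+2 + j * (j + 2))%N; last by lia.
    by rewrite !exprD -mulrA [(P (m - j) * _ * _)^-1]invfM [(P (m - j) * _)^-1]invfM invfM; ring.
  rewrite sum_pair2 mulr_sumr; apply: eq_bigr => r _.
  rewrite (_ : r.+1 ^ 2 = 1 + r * (r + 2))%N; last by lia.
  by rewrite [Q ^+ (1 + _)]exprD expr1 [Q ^+ m.+2]exprS; ring.
rewrite exchange_big /=; apply: eq_bigr => r _.
by rewrite -mulr_sumr -mulr_sumr.
Qed.

(** The summand over m telescopes and the right side is its boundary term. Because of the factor
    Q^(N+1) it disappears in the limit, where each step in r multiplies by -Q. *)
Lemma kappa_rec r N : kappa r.+1 N + Q * kappa r N =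
  (-1) ^+ N.+1 * (1 - Q ^+ (2 * r + 3)) * Q ^+ N.+1 * D N.+1 * P N * rinv N r.+1
  / P (N + r).+2.
Proof.
elim: N => [|N IH].
  by rewrite /kappa !big_ord0 (rinv_gt 0) // !mulr0 !mul0r addr0.
have kS s : kappa s N.+1 = kappa s N + (1 - Q ^+ (2 * s + 2)) *
    (D N.+1 * P N * (-1) ^+ N * Q ^+ N.+1 * rinv N s / P (N + s).+2).
  by rewrite /kappa big_ord_recr mulrDr.
rewrite !kS mulrDr addrACA IH.
case: (leqP r N) => h; last first.
  rewrite (rinv_gt N.+1 r.+1) // (rinv_gt N r) // (rinv_gt N r.+1) ?ltnS 1?ltnW //.
  by ring.
rewrite rinvSS; have -> : rinv N r.+1 = (1 - Q ^+ (N - r)) * rinv N r.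
  by have := rinv_succr (N - r) r; rewrite subnK.
have e1 : Q ^+ (N + r).+3 = Q * Q * Q * (Q ^+ (N - r) * Q ^+ r * Q ^+ r).
  by rewrite -!exprD subnK // -!mulrA -!exprS.
have e2 : Q ^+ (2 * r + 2) = Q * Q * (Q ^+ r * Q ^+ r).
  by rewrite -!exprD -mulrA -!exprS; congr (_ ^+ _); lia.
have e3 : Q ^+ (2 * r + 3) = Q * Q * Q * (Q ^+ r * Q ^+ r).
  by rewrite -!exprD -!mulrA -!exprS; congr (_ ^+ _); lia.
have e4 : Q ^+ (2 * r.+1 + 2) = Q * Q * Q * Q * (Q ^+ r * Q ^+ r).
  by rewrite -!exprD -!mulrA -!exprS; congr (_ ^+ _); lia.
have e5 : Q ^+ N.+1 = Q * (Q ^+ (N - r) * Q ^+ r).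
  by rewrite -!exprD subnK // -exprS.
have ha := P_neq0 (N + r).+2; have := Q_nroot (N + r).+2.
rewrite [(N + r.+1)%N]addnS [(N.+1 + r)%N]addSn (PS (N + r).+2) e1 => h1.
rewrite (DS N.+1) (PS N) ?e2 ?e3 ?e4 [Q ^+ N.+2]exprS e5 ![(-1) ^+ _.+1]exprS.
by field; split_nonzero ha h1.
Qed.

(** The limit 2 Q of this initial value is the source of the factor 2 in the identities for L_5 and
    L_6. *)
Lemma kappa0 N : kappa 0 N =
  2 * Q + (1 - Q) * D N.+1 * (- Q) ^+ N.+1 / P N.+1.
Proof.
elim: N => [|N IH].
  have := Q_nroot 0; rewrite expr1 => h.
  rewrite /kappa big_ord0 DS PS /D /P !qpoch0 expr0 !expr1.
  by field; split_nonzero h h.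
rewrite /kappa big_ord_recr /= mulrDr -/(kappa 0 N) IH.
have -> : rinv N 0 = (P N)^-1 by have := rinv_add N 0; rewrite addn0.
have ha := P_neq0 N; have h1 := Q_nroot N; have h2 := Q_nroot N.+1.
rewrite addn0 (DS N.+1) (PS N.+1) (PS N) !exprS in h1 h2 *.
by rewrite expr0 [(- Q) ^+ N]exprNn; field; rewrite ha /=; split_nonzero h1 h2.
Qed.

(** * Partial sums of L_7 and L_8 *)

Definition gamma r M : C := \sum_(n < M.+1) (-1) ^+ n * ubase n r.

(** The bound K stays free so that two consecutive partial sums can be expanded over the same range
    of r. *)
Lemma double_sum_gamma M K : (M < K)%N ->
  \sum_(n < M.+1) \sum_(k < n.+1) P2 n * (-1) ^+ (n + k)
     * (Q ^+ (k ^ 2 + k) * w ^- k)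
     / (P (n - k) * P2 k * (1 - Q ^+ (2 * k + 1)))
  = \sum_(r < K) (-1) ^+ r * Q ^+ (r ^ 2 + r) * (theta r + theta_shift r) * gamma r M.
Proof.
move=> hK.
transitivity (\sum_(n < M.+1) \sum_(r < K) (-1) ^+ r * Q ^+ (r ^ 2 + r) * (theta r + theta_shift r)
   * ((-1) ^+ n * ubase n r)).
  apply: eq_bigr => -[n hnM] _ /=.
  have hn : (n.+1 <= K)%N by apply: leq_trans hK.
  rewrite -[in RHS](subnKC hn) big_split_ord /= [X in _ + X]big1 ?addr0; last first.
    by move=> i _; rewrite ubase_gt ?addSn ?ltnS ?leq_addr // !(mulr0, mul0r).
  transitivity (P2 n * (-1) ^+ n *
    \sum_(j < n.+1) (-1) ^+ j * w ^- j * Q ^+ (j * (j + 1)) * rinv n j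
      / (P2 j * (1 - Q ^+ (2 * j + 1)))).
    rewrite mulr_sumr; apply: eq_bigr => j _; rewrite -rinvE -1?ltnS //.
    rewrite (_ : j ^ 2 + j = j * (j + 1))%N; last by lia.
    by rewrite !exprD [(P (n - j) * _ * _)^-1]invfM [(P (n - j) * _)^-1]invfM invfM; ring.
  rewrite sum_pair1 mulr_sumr; apply: eq_bigr => r _.
  rewrite (_ : r ^ 2 + r = r * (r + 1))%N; last by lia.
  by rewrite /ubase; ring.
rewrite exchange_big /=; apply: eq_bigr => r _.
by rewrite -mulr_sumr.
Qed.

Lemma gamma_rec r M :
  gamma r M + gamma r.+1 M = (-1) ^+ M * ebase M.+1 r.+1.
Proof.
rewrite /gamma -big_split /=.
under eq_bigr => n _ do rewrite -mulrDr -ebase_rec.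
elim: M => [|M IH]; first by rewrite big_ord1 (ebase_gt 0) // addr0.
by rewrite big_ord_recr IH /= exprS; ring.
Qed.

Lemma gamma0 M : 2 * gamma 0 M = 1 + (-1) ^+ M * ebase M.+1 0.
Proof.
rewrite /gamma mulr_sumr.
under eq_bigr => n _ do rewrite mulrCA -ebase_rec0.
have e0 : ebase 0 0 = 1 by rewrite /ebase /rinv /P /P2 /= !qpoch0 !invr1 !mulr1.
elim: M => [|M IH]; first by rewrite big_ord1 e0 /=; ring.
by rewrite big_ord_recr IH /= exprS; ring.
Qed.
End BaileyPair.
End BaileyPairs.

(** * Ideals of Z[sqrt 3] *)

Lemma OL_mulC x y : OL_mul x y = OL_mul y x.
Proof. by congr pair; ring. Qed.

Lemma OL_mulA x y z : OL_mul x (OL_mul y z) = OL_mul (OL_mul x y) z.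
Proof. by congr pair; rewrite /=; ring. Qed.

Lemma OL_mul1 x : OL_mul (1, 0) x = x.
Proof. by case: x => a b; congr pair; rewrite /=; ring. Qed.

Lemma OL_mulBl x y z : OL_mul (OL_sub x y) z = OL_sub (OL_mul x z) (OL_mul y z).
Proof. by congr pair; rewrite /=; ring. Qed.

Lemma OL_fnormM x y : OL_fnorm (OL_mul x y) = OL_fnorm x * OL_fnorm y.
Proof. by rewrite /OL_fnorm /=; ring. Qed.

(** Irrationality of sqrt 3: the 3-adic valuation of a^2 is even and that of 3 b^2 is odd. *)
Lemma OL_fnorm_eq0 x : OL_fnorm x = 0 -> x = (0, 0).
Proof.
case: x => a b; rewrite /OL_fnorm /= => h.
have : (`|a| ^ 2 = 3 * `|b| ^ 2)%N by lia.
case: (posnP `|b|) => hb; first by move=> ha; congr pair; lia.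
case: (posnP `|a|) => ha; first by rewrite ha => ?; lia.
move/(congr1 (logn 3)); rewrite lognM ?expn_gt0 ?hb // !lognX.
by rewrite (_ : logn 3 3 = 1%N) //; lia.
Qed.

Lemma OL_mul_eq0 x y : OL_mul x y = (0, 0) -> x = (0, 0) \/ y = (0, 0).
Proof.
move=> h; have /eqP := OL_fnormM x y.
rewrite h {1}/OL_fnorm /= expr0n mulr0 subr0 eq_sym mulf_eq0.
by case/orP => /eqP /OL_fnorm_eq0; [left|right].
Qed.

Lemma OL_mulIr x y z : z <> (0, 0) -> OL_mul x z = OL_mul y z -> x = y.
Proof.
move=> hz h; have : OL_mul (OL_sub x y) z = (0, 0).
  by rewrite OL_mulBl h /OL_sub !subrr.
case/OL_mul_eq0 => // -[h1 h2]; case: x y {h} h1 h2 => [a b] [c d] /= h1 h2.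
by congr pair; lia.
Qed.

(* Fundamental domain for the units acting on elements of negative norm; the
   fundamental unit is 2 + sqrt 3. *)
Definition in_cone (x : OL) : bool := [&& 0 < x.2, - x.2 <= x.1 & x.1 < x.2].

Definition OL_unit1 (e : OL) : Prop :=
  OL_fnorm e = 1 /\ exists e', OL_mul e' e = (1, 0).

Lemma OL_unit1M e f : OL_unit1 e -> OL_unit1 f -> OL_unit1 (OL_mul e f).
Proof.
move=> [he [e' he']] [hf [f' hf']]; split; first by rewrite OL_fnormM he hf.
exists (OL_mul f' e'); rewrite -OL_mulA [OL_mul e' _]OL_mulA he' OL_mul1.
exact: hf'.
Qed.

(** Descent on b, with [n] as fuel: outside the cone, multiplication by 2 - sqrt 3 or 2 + sqrt 3
    replaces b by 2b - |a|. This is positive because a^2 < 3 b^2, and smaller than b when |a| >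
    b. *)
Lemma in_cone_exists x : OL_fnorm x < 0 ->
  exists e, OL_unit1 e /\ in_cone (OL_mul e x).
Proof.
wlog hpos : x / 0 < x.2.
  move=> hw hx; have [h|h|h] := ltgtP 0 x.2.
  - exact: hw.
  - have u : OL_unit1 (-1, 0) by split => //; exists (-1, 0).
    have [||e [he ce]] := hw (OL_mul (-1, 0) x).
    + by rewrite /=; lia.
    + by rewrite OL_fnormM (proj1 u) mul1r.
    exists (OL_mul e (-1, 0)); split; first exact: OL_unit1M.
    by rewrite -OL_mulA.
  - by move: hx; rewrite /OL_fnorm -h; nia.
have [n hn] : exists n : nat, (`|x.2| <= n)%N by exists `|x.2|%N.
elim: n x hpos hn => [|n IH] [a b] /= hpos hn; first by lia.
rewrite /OL_fnorm /= => hx.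
have [h1|h1] := lerP b a.
  have u : OL_unit1 (2, -1) by split => //; exists (2, 1).
  (* On the ray a = b the descent would stall, but one multiplication lands on a = -b, the boundary
     ray that belongs to the cone. *)
  have [h2|h2] := eqVneq a b.
    exists (2, -1); split => //; rewrite /in_cone /=; lia.
  have hb : 0 < 2 * b - a by nia.
  have [|||e [he ce]] := IH (OL_mul (2, -1) (a, b)).
  - by rewrite /=; lia.
  - by rewrite /=; lia.
  - by rewrite OL_fnormM (proj1 u) mul1r.
  by exists (OL_mul e (2, -1)); split; [exact: OL_unit1M|rewrite -OL_mulA].
have [h2|h2] := lerP (- b) a.
  exists (1, 0); split; first by split => //; exists (1, 0).
  by rewrite OL_mul1 /in_cone /= hpos h2 h1.
have u : OL_unit1 (2, 1) by split => //; exists (2, -1).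
have hb : 0 < 2 * b + a by nia.
have [|||e [he ce]] := IH (OL_mul (2, 1) (a, b)).
- by rewrite /=; lia.
- by rewrite /=; lia.
- by rewrite OL_fnormM (proj1 u) mul1r.
by exists (OL_mul e (2, 1)); split; [exact: OL_unit1M|rewrite -OL_mulA].
Qed.

Lemma in_cone_fnorm x : in_cone x -> OL_fnorm x < 0.
Proof. by case: x => a b /and3P[/= h1 h2 h3]; rewrite /OL_fnorm /=; nia. Qed.

(** If d > 0 then d <= c <= 2 d, and a >= -b gives (c - d) a + (3 d - c) b >= (4 d - 2 c) b >= 0:
    the image lies on or beyond the excluded ray a = b. *)
Lemma in_cone_unit_le y c d : in_cone y -> c ^+ 2 - 3 * d ^+ 2 = 1 ->
  in_cone (OL_mul (c, d) y) -> d <= 0.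
Proof.
case: y => a b /and3P[/= h1 h2 h3] hcd /and3P[/= h4 h5 h6].
rewrite leNgt; apply/negP => hd.
have hc0 : 0 < c.
  rewrite ltNge; apply/negP => hc.
  have hcd' : d <= - c by nia.
  by nia.
have hc : c <= 2 * d by nia.
have hcd' : d <= c by nia.
have : 0 <= (c - d) * (a + b) by rewrite mulr_ge0 // ?subr_ge0 //; lia.
by nia.
Qed.

(** [in_cone_unit_le] applied to the unit and to its conjugate, which is its inverse, forces d = 0;
    the sign of b then excludes c = -1. *)
Lemma in_cone_unique x y e : in_cone x -> in_cone y -> OL_fnorm e = 1 ->
  x = OL_mul e y -> x = y.
Proof.
case: e => c d hx hy; rewrite /OL_fnorm /= => he hxy.
have hd1 : d <= 0 by apply: (in_cone_unit_le y c d) => //; rewrite -hxy.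
have hyx : y = OL_mul (c, - d) x.
  rewrite hxy OL_mulA (_ : OL_mul _ (c, d) = (1, 0)) ?OL_mul1 //.
  by congr pair; rewrite /=; [rewrite -[RHS]he|]; ring.
have hd2 : - d <= 0.
  by apply: (in_cone_unit_le x c (- d)) => //; [rewrite sqrrN|rewrite -hyx].
have d0 : d = 0 by lia.
rewrite d0 in he hxy; have : c = 1 \/ c = -1 by nia.
case=> hc; rewrite hc in hxy; first by rewrite hxy OL_mul1.
move: hx hy; rewrite hxy; case: (y) => a b /and3P[/= ? _ _] /and3P[/= ? _ _].
by lia.
Qed.

(** * Euclidean division, principal ideals and ideal norms *)

Lemma nearest_quotient (s D : int) : D != 0 ->
  exists k, 2 * `|s - k * D| <= `|D|.
Proof.
move=> hD; have e := divz_eq s D; have h1 := modz_ge0 s hD.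
have h2 := ltz_mod s hD.
have [h|h] := lerP (2 * (s %% D)%Z) `|D|.
  exists (s %/ D)%Z; rewrite {1}e addrC addKr ger0_norm //.
have [hp|hn] := ltrP 0 D.
  by exists ((s %/ D)%Z + 1); rewrite {1}e mulrDl; lia.
by exists ((s %/ D)%Z - 1); rewrite {1}e mulrBl; lia.
Qed.

(** Both coordinates of y / x are rounded. With D = N(x) cleared, the errors satisfy |p|, |q| <= |D|
    / 2, and |p^2 - 3 q^2| <= 3 D^2 / 4 because the two terms have opposite signs. *)
Lemma OL_euclid x y : x <> (0, 0) ->
  exists t, `|OL_fnorm (OL_sub y (OL_mul t x))| < `|OL_fnorm x|.
Proof.
move=> hx; have hD : OL_fnorm x != 0 by apply/eqP => /OL_fnorm_eq0.
have [s hs] := nearest_quotient (y.1 * x.1 - 3 * y.2 * x.2) _ hD.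
have [t ht] := nearest_quotient (y.2 * x.1 - y.1 * x.2) _ hD.
exists (s, t); move: hs ht.
set p := y.1 * x.1 - _ - _; set q := y.2 * x.1 - _ - _ => hp hq.
have e : OL_fnorm (OL_sub y (OL_mul (s, t) x)) * OL_fnorm x = p ^+ 2 - 3 * q ^+ 2.
  by rewrite /p /q /OL_fnorm /=; ring.
move: hD hp hq e; move: p q => p q.
move: (OL_fnorm (OL_sub _ _)) (OL_fnorm x) => z D hD hp hq e.
rewrite -(@ltr_pM2r _ `|D|) ?normr_gt0 // -normrM e.
have hp2 : 4 * p ^+ 2 <= `|D| * `|D|.
  by rewrite (_ : 4 * p ^+ 2 = (2 * `|p|) * (2 * `|p|)) ?ler_pM //; rewrite -real_normK ?num_real //; ring.
have hq2 : 4 * q ^+ 2 <= `|D| * `|D|.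
  by rewrite (_ : 4 * q ^+ 2 = (2 * `|q|) * (2 * `|q|)) ?ler_pM //; rewrite -real_normK ?num_real //; ring.
have hD2 : 0 < `|D| * `|D| by rewrite mulr_gt0 ?normr_gt0.
have := sqr_ge0 p; have := sqr_ge0 q.
by move: (p ^+ 2) (q ^+ 2) (`|D| * `|D|) hp2 hq2 hD2 => P Q E; lia.
Qed.

Lemma absz_ltn (a h : int) : 0 <= a -> a < `|h| -> (`|a| < `|h|)%N.
Proof. lia. Qed.

Lemma absz_subn_lt (a h : int) (n : nat) :
  0 <= a -> a < `|h| -> (n < `|h|)%N -> `|a - n%:Z| < `|h|.
Proof. lia. Qed.

Lemma absz_subn_eq0 (a : int) (n : nat) : 0 <= a -> a - n%:Z = 0 -> `|a|%N = n.
Proof. lia. Qed.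

(* Hermite normal form: the ideal (a + b sqrt 3) is spanned over Z by elements
   (h, 0) and (c, g) with g = gcd(a, b) and g h = |N(a + b sqrt 3)|. *)
Lemma OL_transversal x : x <> (0, 0) ->
  exists r : 'I_(`|OL_fnorm x|) -> OL, forall y,
    exists! i, exists t, OL_sub y (r i) = OL_mul t x.
Proof.
case: x => a b hx; have hD : OL_fnorm (a, b) != 0 by apply/eqP => /OL_fnorm_eq0.
have [u [v huv]] := Bezoutz a b.
have hg : gcdz a b != 0.
  rewrite gcdz_eq0; apply/negP => /andP[/eqP ha /eqP hb]; apply: hx.
  by rewrite ha hb.
have [a' ha] : exists a', a = a' * gcdz a b by apply/dvdzP/dvdz_gcdl.
have [b' hb] : exists b', b = b' * gcdz a b by apply/dvdzP/dvdz_gcdr.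
have : 0 <= gcdz a b by [].
move: (gcdz a b) huv hg ha hb => g huv hg ha hb hg0.
have {}hg0 : 0 < g by lia.
have huv1 : u * a' + v * b' = 1.
  by apply: (mulIf hg); rewrite mul1r -{2}huv ha hb; ring.
set D' := a' ^+ 2 - 3 * b' ^+ 2.
have eD : OL_fnorm (a, b) = g * g * D' by rewrite /OL_fnorm /D' /= ha hb; ring.
have hD' : D' != 0 by apply: contraNneq hD => h; rewrite eD h mulr0.
have en : `|OL_fnorm (a, b)|%N = (`|g| * (`|g| * `|D'|))%N.
  by rewrite eD !abszM mulnA.
have hgn : (0 < `|g|)%N by lia.
have hhn : (0 < `|g| * `|D'|)%N by rewrite muln_gt0 hgn absz_gt0.
rewrite en.
exists (fun i => ((i %/ `|g|)%N%:Z, (i %% `|g|)%N%:Z)) => -[s t].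
pose t2 := (t %/ g)%Z; pose s' := s - t2 * (v * a + 3 * u * b).
pose h := g * D'.
have hh : h != 0 by rewrite mulf_neq0.
have et := divz_eq t g; have es := divz_eq s' h.
have ht1 := modz_ge0 t hg; have ht2 := ltz_mod t hg.
have hs1 := modz_ge0 s' hh; have hs2 := ltz_mod s' hh.
have eh : (`|h| = `|g| * `|D'|)%N by rewrite abszM.
pose i0 := (`|(s' %% h)%Z| * `|g| + `|(t %% g)%Z|)%N.
have hi0 : (i0 < `|g| * (`|g| * `|D'|))%N.
  rewrite /i0 -eh [X in (_ < X)%N]mulnC.
  apply: (@leq_trans ((`|(s' %% h)%Z|.+1) * `|g|)).
    by rewrite mulSn addnC ltn_add2r absz_ltn.
  by rewrite leq_mul2r absz_ltn ?orbT.
have d1 : (i0 %/ `|g|)%N%:Z = (s' %% h)%Z.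
  by rewrite /i0 divnMDl // divn_small ?addn0 ?gez0_abs // absz_ltn.
have d2 : (i0 %% `|g|)%N%:Z = (t %% g)%Z.
  by rewrite /i0 modnMDl modn_small ?gez0_abs // absz_ltn.
exists (Ordinal hi0); split.
  (* The multiplier (v, u) takes x to the basis vector with second coordinate g, and (a', - b')
     takes it to (h, 0). *)
  exists (t2 * v + (s' %/ h)%Z * a', t2 * u - (s' %/ h)%Z * b').
  rewrite /= d1 d2; congr pair => /=.
    rewrite (_ : s = s' + t2 * (v * a + 3 * u * b)); last by rewrite /s'; ring.
    by rewrite {1}es /h /D' ha hb; ring.
  by rewrite {1}et -/t2 (_ : t2 * g = t2 * (u * a + v * b)) ?addrK; [rewrite ha hb; ring|rewrite huv].
move=> i [[m n]] [/= e1 e2].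
pose m0 := m - (t2 * v + (s' %/ h)%Z * a').
pose n0 := n - (t2 * u - (s' %/ h)%Z * b').
have f2 : (t %% g)%Z - (i %% `|g|)%N%:Z = g * (m0 * b' + n0 * a').
  rewrite (_ : (t %% g)%Z = t - t2 * (u * a + v * b)); last by rewrite huv {2}et; ring.
  rewrite addrAC e2 /m0 /n0 ha hb; ring.
have f1 : (s' %% h)%Z - (i %/ `|g|)%N%:Z = g * (m0 * a' + 3 * n0 * b').
  rewrite (_ : (s' %% h)%Z = s - t2 * (v * a + 3 * u * b) - (s' %/ h)%Z * h).
    by rewrite addrAC [in X in X - _]addrAC e1 /m0 /n0 /h /D' ha hb; ring.
  by rewrite -/s' {2}es; ring.
have small_mul (z k c : int) : `|z| < `|c| -> z = c * k -> z = 0.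
  move=> h1 h2; have [k0|k0] := eqVneq k 0; first by rewrite h2 k0 mulr0.
  move: h1; rewrite h2 normrM ltNge ler_peMr ?normr_ge0 //.
  by rewrite -gtz0_ge1 normr_gt0.
have z2 : (t %% g)%Z - (i %% `|g|)%N%:Z = 0.
  by apply: (small_mul _ _ g) f2; apply: absz_subn_lt; rewrite // ltn_pmod.
have hmn : m0 * b' = - (n0 * a').
  by apply/eqP; rewrite -addr_eq0; move: f2; rewrite z2 => /esym/eqP; rewrite mulf_eq0 (negbTE hg).
(* By [hmn] and the coprimality of a' and b', the pair (m0, n0) is an integer multiple of (a', -
   b'), so the remaining difference is a multiple of h. *)
have hm0 : m0 = a' * (u * m0 - v * n0).
  transitivity (m0 * (u * a' + v * b')); first by rewrite huv1 mulr1.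
  by rewrite mulrDr [m0 * (v * _)]mulrCA hmn; ring.
have hn0 : n0 = - b' * (u * m0 - v * n0).
  transitivity (n0 * (u * a' + v * b')); first by rewrite huv1 mulr1.
  rewrite mulrDr [n0 * (u * _)]mulrCA -[n0 * a']opprK -hmn; ring.
have z1 : (s' %% h)%Z - (i %/ `|g|)%N%:Z = 0.
  apply: (small_mul _ (u * m0 - v * n0) h).
    by apply: absz_subn_lt; rewrite // eh ltn_divLR // -[X in (_ < X)%N]mulnC ltn_ord.
  rewrite f1; have -> : m0 * a' + 3 * n0 * b' =
      a' * (u * m0 - v * n0) * a' + 3 * (- b' * (u * m0 - v * n0)) * b'.
    by rewrite -hm0 -hn0.
  by rewrite /h /D'; ring.
apply: val_inj; rewrite /= (divn_eq i `|g|) /i0.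
by congr (_ * _ + _)%N; apply: absz_subn_eq0.
Qed.

Definition principal_ideal (x : OL) : set OL := [set y | exists t, y = OL_mul t x].

Lemma OL_subxx x : OL_sub x x = (0, 0).
Proof. by rewrite /OL_sub !subrr. Qed.

Lemma OL_sub_sub x y z : OL_sub (OL_sub x z) (OL_sub x y) = OL_sub y z.
Proof. by congr pair; rewrite /=; ring. Qed.

Lemma nonzero_principal_ideal x : x <> (0, 0) -> nonzero_ideal (principal_ideal x).
Proof.
move=> hx; split.
- by exists (0, 0); congr pair; rewrite /=; ring.
- by move=> _ _ [s ->] [t ->]; exists (OL_sub s t); rewrite OL_mulBl.
- by move=> r _ [s ->]; exists (OL_mul r s); rewrite OL_mulA.
- by exists x; split => //; exists (1, 0); rewrite OL_mul1.
Qed.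

Lemma nonzero_ideal_principal I : nonzero_ideal I ->
  exists2 x, x <> (0, 0) & I = principal_ideal x.
Proof.
case=> I0 Isub Imul [x [Ix hx]].
have [n hn] : exists n : nat, (`|OL_fnorm x| <= n)%N by exists `|OL_fnorm x|%N.
elim: n x Ix hx hn => [|n IH] x Ix hx hn.
  by case: hx; apply: OL_fnorm_eq0; lia.
have [h|h] := pselect (exists2 y, I y & ~ principal_ideal x y); last first.
  exists x => //; apply/seteqP; split => y; last by move=> [t ->]; apply: Imul.
  by move=> Iy; apply: contrapT => hy; apply: h; exists y.
case: h => y Iy hy; have [t ht] := OL_euclid x y hx.
apply: (IH (OL_sub y (OL_mul t x))).
- by apply: Isub => //; apply: Imul.
- move=> [h1 h2]; apply: hy; exists t; case: (y) h1 h2 => a b /= h1 h2.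
  by congr pair; lia.
- by lia.
Qed.

(** Each representative of one system is sent to the representative of its class in the other; this
    map is injective. By symmetry an ideal has at most one norm. *)
Lemma ideal_norm_le I m n : nonzero_ideal I ->
  ideal_norm_is I m -> ideal_norm_is I n -> (m <= n)%N.
Proof.
move=> [I0 Isub _ _] [r hr] [s hs].
have /choice[f hf] : forall i, exists j, I (OL_sub (r i) (s j)).
  by move=> i; have [j [hj _]] := hs (r i); exists j.
suff : injective f by move/leq_card; rewrite !card_ord.
move=> i j hij; have [k [hk uk]] := hr (s (f i)).
have sym a b : I (OL_sub a b) -> I (OL_sub b a).
  by move=> h; rewrite -(OL_sub_sub a b a); apply: Isub; rewrite // OL_subxx.
by rewrite -(uk i) ?(uk j) //; apply: sym; rewrite // hij.
Qed.

Lemma ideal_norm_principal x n : x <> (0, 0) ->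
  ideal_norm_is (principal_ideal x) n <-> n = `|OL_fnorm x|%N.
Proof.
move=> hx; have h := OL_transversal x hx.
have hI := nonzero_principal_ideal x hx.
split=> [hn|->] //.
by apply/eqP; rewrite eqn_leq !(ideal_norm_le (principal_ideal x)).
Qed.

Lemma principal_ideal_unit e x : OL_unit1 e ->
  principal_ideal (OL_mul e x) = principal_ideal x.
Proof.
move=> [_ [f hf]]; apply/seteqP; split => _ [t ->].
  by exists (OL_mul t e); rewrite OL_mulA.
by exists (OL_mul t f); rewrite -[OL_mul (OL_mul t f) _]OL_mulA [OL_mul f _]OL_mulA hf OL_mul1.
Qed.

Lemma in_cone_neq0 x : in_cone x -> x <> (0, 0).
Proof. by move=> h hx; move: h; rewrite hx. Qed.

Lemma principal_ideal_eq x y : x <> (0, 0) -> 0 < OL_fnorm x * OL_fnorm y ->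
  principal_ideal x = principal_ideal y ->
  exists e, OL_fnorm e = 1 /\ x = OL_mul e y.
Proof.
move=> hx hs hxy.
have [e he] : principal_ideal y x.
  by rewrite -hxy; exists (1, 0); rewrite OL_mul1.
have [f hf] : principal_ideal x y.
  by rewrite hxy; exists (1, 0); rewrite OL_mul1.
exists e; split=> //.
have hef : OL_mul e f = (1, 0).
  by apply: (OL_mulIr _ _ x hx); rewrite OL_mul1 -OL_mulA -hf.
have := OL_fnormM e f; rewrite hef {1}/OL_fnorm /= => h1.
move: hs; rewrite {1}he OL_fnormM -mulrA -expr2 => h2.
have h0 : 0 <= OL_fnorm y ^+ 2 := sqr_ge0 _.
have : 0 < OL_fnorm e by rewrite ltNge; apply/negP => h3; nia.
move: h1; rewrite expr1n expr0n mulr0 subr0.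
move: (OL_fnorm e) (OL_fnorm f) => a b hab ha.
have hb : 0 < b by nia.
by nia.
Qed.

(** * Counting ideals by lattice points *)

Lemma in_cone_ideal_inj x y : in_cone x -> in_cone y ->
  principal_ideal x = principal_ideal y -> x = y.
Proof.
move=> hx hy h.
have [|e [he hxy]] := principal_ideal_eq x y (in_cone_neq0 x hx) _ h.
  by rewrite nmulr_lgt0 ?in_cone_fnorm.
exact: in_cone_unique he hxy.
Qed.

(** [fset_set] returns the empty set on an infinite set, so the count is meaningful only once the
    ideals are exhibited as the image of a finite list. *)
Lemma ideal_count_size (P : set OL -> Prop) n (T : eqType) (s : seq T) (g : T -> OL) :
  uniq s ->
  {in s &, injective (fun p => principal_ideal (g p))} ->
  (forall I, (nonzero_ideal I /\ ideal_norm_is I n /\ P I) <->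
             (exists2 p, p \in s & I = principal_ideal (g p))) ->
  ideal_count P n = size s.
Proof.
move=> us ginj hI; rewrite /ideal_count.
rewrite (_ : [set I | _] = [set` [fset I in [seq principal_ideal (g p) | p <- s]]%fset]).
  by rewrite set_fsetK card_fseq undup_id ?size_map // map_inj_in_uniq.
apply/seteqP; split => I /=; rewrite inE /= hI.
  by move=> [p hp ->]; apply/mapP; exists p.
by move/mapP => [p hp ->]; exists p.
Qed.

Definition tri (len : nat -> nat) (N : nat) : seq (nat * nat) :=
  [seq (r, k) | r <- iota 0 N, k <- iota 0 (len r)].

Lemma mem_tri len N r k : ((r, k) \in tri len N) = (r < N)%N && (k < len r)%N.
Proof.
apply/allpairsPdep/andP => [[r' [k' [+ + [-> ->]]]]|[hr hk]].
  by rewrite !mem_iota.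
by exists r, k; rewrite !mem_iota.
Qed.

Lemma uniq_tri len N : uniq (tri len N).
Proof.
apply: allpairs_uniq_dep; first exact: iota_uniq.
  by move=> x _; apply: iota_uniq.
by move=> [a b] [c d] _ _ /= [-> ->].
Qed.

Lemma odd_abszD (m n : int) : odd `|m + n| = odd `|m| (+) odd `|n|.
Proof. by lia. Qed.

Lemma odd_fnorm x : odd `|OL_fnorm x| = odd `|x.1| (+) odd `|x.2|.
Proof.
by rewrite /OL_fnorm odd_abszD abszN !abszM !oddM /= !andbb.
Qed.

(** In row r the second coordinate is r + 1 and the cone leaves the first one in [-(r + 1), r + 1).
    The indices k = 0, ..., r run through the values of one parity there; [b] is true for even
    norm. *)
Definition neg_pt (b : bool) (p : nat * nat) : OL :=
  (p.1%:Z - (2 * p.2 + b)%N%:Z, p.1.+1%:Z).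

Lemma neg_pt_cone b r k : (k < r.+1)%N -> in_cone (neg_pt b (r, k)).
Proof. by move=> h; rewrite /in_cone /neg_pt /=; case: b; lia. Qed.

Lemma neg_pt_parity b r k : (k < r.+1)%N ->
  odd `|OL_fnorm (neg_pt b (r, k))| = ~~ b.
Proof.
by move=> h; rewrite odd_fnorm /neg_pt /=; case: b; lia.
Qed.

Lemma cone_neg_pt (b : bool) x : in_cone x -> odd `|OL_fnorm x| = ~~ b ->
  exists r k, (k < r.+1)%N /\ x = neg_pt b (r, k).
Proof.
case: x => a c /and3P[/= h1 h2 h3]; rewrite odd_fnorm /= => h4.
have hm : odd `|(c - 1 - a)%R| = b by lia.
have e := odd_double_half `|(c - 1 - a)%R|; rewrite hm in e.
exists `|c|.-1, (`|(c - 1 - a)%R|./2); split; first by lia.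
by rewrite /neg_pt; congr pair => /=; lia.
Qed.

(** A cone point in row r has norm at least 2 (r + 1)^2 in absolute value, so the rows r < N contain
    every generator of norm n. *)
Lemma ideal_count_neg (b : bool) n N : (n < N)%N -> odd n = ~~ b ->
  ideal_count principal_neg n =
  size [seq p <- tri (fun r => r.+1) N | `|OL_fnorm (neg_pt b p)|%N == n].
Proof.
move=> hnN hn; apply: (ideal_count_size _ _ _ _ (neg_pt b)).
- by rewrite filter_uniq ?uniq_tri.
- move=> [r k] [r' k']; rewrite !mem_filter !mem_tri => /and3P[_ _ hk] /and3P[_ _ hk'] h.
  have := in_cone_ideal_inj _ _ (neg_pt_cone b r k hk) (neg_pt_cone b r' k' hk') h.
  by rewrite /neg_pt /= => -[h1 h2]; congr pair; lia.
- move=> I; split.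
    move=> [_ [hIn [x [hx hxneg]]]].
    have eI : I = principal_ideal x by apply/seteqP; split => y /hx.
    have [e [he hc]] := in_cone_exists x hxneg.
    have hne := in_cone_neq0 _ hc.
    have eI' : I = principal_ideal (OL_mul e x) by rewrite principal_ideal_unit.
    have en : n = `|OL_fnorm (OL_mul e x)|%N.
      by apply/ideal_norm_principal; rewrite // -eI'.
    have [|r [k [hk ek]]] := cone_neg_pt b _ hc; first by rewrite -en.
    exists (r, k); last by rewrite -ek.
    rewrite mem_filter mem_tri hk andbT -ek -en eqxx /=; apply: leq_trans hnN.
    have := neg_pt_cone b r k hk; rewrite en ek /in_cone /OL_fnorm /neg_pt /=.
    by move: (_ - (2 * k + b)%N%:Z) => a; nia.
move=> [[r k]]; rewrite mem_filter mem_tri => /and3P[/eqP hn' hr hk] ->.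
have hc := neg_pt_cone b r k hk; have hne := in_cone_neq0 _ hc.
split; first exact: nonzero_principal_ideal.
split; first by apply/ideal_norm_principal.
by exists (neg_pt b (r, k)); split; [|exact: in_cone_fnorm].
Qed.

(** The first coordinate is prime to 3, hence 3r + 1 or 3r + 2; in both cases the cone condition
    bounds the second coordinate by r in absolute value. The parity of the norm selects between the
    two, whence the term [odd p.2 (+) b]. *)
Definition pos_pt (b : bool) (p : nat * nat) : OL :=
  ((3 * p.1 + 1 + (odd p.2 (+) b))%N%:Z, p.1%:Z - p.2%:Z).

(* Multiplication by sqrt 3 reduces generators of positive norm to [in_cone];
   since their norm is prime to 3, the image has strict inequalities. *)
Definition sqrt3 : OL := (0, 1).

Lemma pos_pt_cone b r k : (k < (2 * r).+1)%N -> in_cone (OL_mul sqrt3 (pos_pt b (r, k))).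
Proof. by move=> h; rewrite /in_cone /pos_pt /=; case: (_ (+) b); lia. Qed.

Lemma pos_pt_parity b r k : (k < (2 * r).+1)%N ->
  odd `|OL_fnorm (pos_pt b (r, k))| = ~~ b.
Proof.
move=> h; rewrite odd_fnorm /pos_pt /=.
have : odd `|(r%:Z - k%:Z)%R| = odd r (+) odd k by lia.
move=> ->; by rewrite !oddD ?oddM; case: (odd r); case: (odd k); case: b.
Qed.

Lemma pos_pt_mod3 b r k : (k < (2 * r).+1)%N ->
  (`|OL_fnorm (pos_pt b (r, k))| %% 3 = 1)%N.
Proof.
move=> h; rewrite /OL_fnorm /pos_pt /=; move: (_ (+) b) => c.
have : - r%:Z <= r%:Z - k%:Z <= r%:Z by lia.
move: (r%:Z - k%:Z) => a ha.
have ha2 : a ^+ 2 <= r%:Z ^+ 2 by nia.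
have [m ->] : exists m : nat, (3 * r + 1 + c)%N%:Z ^+ 2 - 3 * a ^+ 2 = (3 * m + 1)%N%:Z.
  exists `|(3 * r%:Z ^+ 2 + 2 * r%:Z + c%:Z * (2 * r%:Z + 1) - a ^+ 2)%R|%N.
  by case: c; nia.
by lia.
Qed.

Lemma cone_pos_pt (b : bool) x : in_cone (OL_mul sqrt3 x) ->
  odd `|OL_fnorm x| = ~~ b -> (`|OL_fnorm x| %% 3 = 1)%N ->
  exists r k, (k < (2 * r).+1)%N /\ x = pos_pt b (r, k).
Proof.
case: x => a c /and3P[/= h1 h2 h3]; rewrite odd_fnorm /= => h4 h5.
have e := divn_eq `|a| 3; have hlt := ltn_pmod `|a| (isT : 0 < 3)%N.
have h0 : (`|a| %% 3 != 0)%N.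
  apply: contraTneq isT => h0; rewrite h0 addn0 in e; exfalso.
  have ea : a = 3 * (`|a| %/ 3)%N%:Z by lia.
  move: h5; rewrite /OL_fnorm /= ea; move: (_ %/ _)%N => r.
  have -> : (3 * r%:Z) ^+ 2 - 3 * c ^+ 2 = 3 * (3 * r%:Z ^+ 2 - c ^+ 2) by ring.
  by rewrite abszM modnMr.
move: e hlt h0; move: (`|a| %/ 3)%N (`|a| %% 3)%N => r s e hlt h0.
exists r, `|(r%:Z - c)%R|%N; split; first by clear h4 h5; lia.
have hs : (s = 1 \/ s = 2)%N by lia.
have hk : odd `|(r%:Z - c)%R| = odd r (+) odd `|c| by clear; lia.
have ha : odd `|a| = odd r (+) odd s by rewrite e oddD oddM andbT.
have hrc : `|(r%:Z - c)%R|%N%:Z = r%:Z - c by clear h4 h5 hk; lia.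
rewrite /pos_pt /= hk; congr pair; last by rewrite hrc subKr.
have : odd r (+) odd `|c| (+) b = (s == 2)%N.
  by move: h4; rewrite ha; case: hs => ->; case: (odd r); case: (odd `|c|); case: (b).
by move=> ->; case: hs e => ->; clear - h1; lia.
Qed.

(** The norm is a square modulo 3, so a negative one has absolute value 0 or 2 modulo 3. *)
Lemma fnorm_pos_mod3 x : (`|OL_fnorm x| %% 3 = 1)%N -> 0 < OL_fnorm x.
Proof.
case: x => a c; rewrite /OL_fnorm /= => h; rewrite ltNge; apply/negP => hle.
have e := divz_eq a 3; have h1 := modz_ge0 a (isT : 3 != 0 :> int).
have h2 := ltz_mod a (isT : 3 != 0 :> int).
have [m hm] : exists m : nat, 3 * c ^+ 2 - a ^+ 2 = 3 * m%:Z + 1.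
  exists (`|(a ^+ 2 - 3 * c ^+ 2)%R| %/ 3)%N.
  by have := divn_eq `|(a ^+ 2 - 3 * c ^+ 2)%R| 3; rewrite h; lia.
move: e h1 h2; move: (a %/ 3)%Z (a %% 3)%Z => u t e h1 h2.
have ht : t = 0 \/ t = 1 \/ t = 2 by lia.
have : exists k : int, a ^+ 2 = 3 * k \/ a ^+ 2 = 3 * k + 1.
  case: ht => [|[|]] et; rewrite e et.
  - by exists (3 * u ^+ 2); left; ring.
  - by exists (3 * u ^+ 2 + 2 * u); right; ring.
  - by exists (3 * u ^+ 2 + 4 * u + 1); right; ring.
by move: hm; move: (a ^+ 2) (c ^+ 2) => A C hm [k [hk|hk]]; lia.
Qed.

Lemma principal_ideal_sqrt3_inj x y :
  principal_ideal x = principal_ideal y ->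
  principal_ideal (OL_mul sqrt3 x) = principal_ideal (OL_mul sqrt3 y).
Proof.
have sub a b : principal_ideal a `<=` principal_ideal b ->
    principal_ideal (OL_mul sqrt3 a) `<=` principal_ideal (OL_mul sqrt3 b).
  move=> h _ [t ->].
  have [s hs] : principal_ideal b a by apply: h; exists (1, 0); rewrite OL_mul1.
  exists (OL_mul t s).
  by rewrite hs !OL_mulA -[OL_mul (OL_mul t _) s]OL_mulA [OL_mul sqrt3 s]OL_mulC OL_mulA.
by move=> h; apply/seteqP; split; apply: sub; rewrite h.
Qed.

(** The residue 1 modulo 3 makes the norm of every generator positive; sqrt 3 has norm -3, so
    multiplying by it gives access to the unique cone representative. *)
Lemma ideal_count_pos (b : bool) n N : (n < N)%N -> odd n = ~~ b -> (n %% 3 = 1)%N ->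
  ideal_count (fun _ => True) n =
  size [seq p <- tri (fun r => (2 * r).+1) N | `|OL_fnorm (pos_pt b p)|%N == n].
Proof.
move=> hnN hn hn3; apply: (ideal_count_size _ _ _ _ (pos_pt b)).
- by rewrite filter_uniq ?uniq_tri.
- move=> [r k] [r' k']; rewrite !mem_filter !mem_tri => /and3P[_ _ hk] /and3P[_ _ hk'].
  move=> /principal_ideal_sqrt3_inj h.
  have := in_cone_ideal_inj _ _ (pos_pt_cone b r k hk) (pos_pt_cone b r' k' hk') h.
  move=> e; have h1 := congr1 fst e; have h2 := congr1 snd e; move: h1 h2 => {e h}.
  rewrite /pos_pt /=; have b2 (c : bool) : (c <= 1)%N by case: c.
  move: (odd k (+) b) (odd k' (+) b) => c c' h1 h2.
  by have := b2 c; have := b2 c'; clear - h1 h2 => ? ?; congr pair; lia.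
- move=> I; split.
    move=> [hI [hIn _]]; have [x hx eI] := nonzero_ideal_principal I hI.
    have en : n = `|OL_fnorm x|%N by apply/ideal_norm_principal; rewrite // -eI.
    have hpos : 0 < OL_fnorm x by apply: fnorm_pos_mod3; rewrite -en.
    have [|e [he hc]] := in_cone_exists (OL_mul sqrt3 x).
      by rewrite OL_fnormM (_ : OL_fnorm sqrt3 = - 3) // nmulr_rlt0.
    have en' : n = `|OL_fnorm (OL_mul e x)|%N by rewrite OL_fnormM (proj1 he) mul1r.
    have [|||r [k [hk ek]]] := cone_pos_pt b (OL_mul e x).
    + by rewrite OL_mulA [OL_mul sqrt3 e]OL_mulC -OL_mulA.
    + by rewrite -en'.
    + by rewrite -en'.
    exists (r, k); last by rewrite -ek principal_ideal_unit.
    rewrite mem_filter mem_tri hk andbT -ek -en' eqxx /=; apply: leq_trans hnN.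
    rewrite en' ek /OL_fnorm /pos_pt /=; move: (_ (+) b) => c.
    have : - r%:Z <= r%:Z - k%:Z <= r%:Z by lia.
    move: (r%:Z - k%:Z) => a; nia.
move=> [[r k]]; rewrite mem_filter mem_tri => /and3P[/eqP hn' hr hk] ->.
have hne : pos_pt b (r, k) <> (0, 0) by rewrite /pos_pt /= => -[]; lia.
split; first exact: nonzero_principal_ideal.
by split; first by apply/ideal_norm_principal.
Qed.

(** * Convergence *)

Section ComplexModulus.
Variable R : realType.
Implicit Types (z : Cx R) (u v : nat -> Cx R).

(** The norm of [Cx R] takes its values in [Cx R]; a modulus in [R] makes squeezing and comparison
    of real series applicable. *)
Definition cmod z : R := complex.Re (`|z| : R[i]).

Lemma cmodE z : `|z| = ((cmod z)%:C)%C :> Cx R.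
Proof. by rewrite /cmod RRe_real // normr_real. Qed.

Lemma cmod_inj (a b : R) : (a%:C)%C = (b%:C)%C :> Cx R -> a = b.
Proof. by case. Qed.

Lemma cmod_ge0 z : 0 <= cmod z.
Proof. by rewrite -lecR -cmodE normr_ge0. Qed.

Lemma cmod0 : cmod 0 = 0.
Proof. by apply: cmod_inj; rewrite -cmodE normr0. Qed.

Lemma cmod1 : cmod 1 = 1.
Proof. by apply: cmod_inj; rewrite -cmodE normr1. Qed.

Lemma cmodN z : cmod (- z) = cmod z.
Proof. by apply: cmod_inj; rewrite -!cmodE normrN. Qed.

Lemma cmodM z y : cmod (z * y) = cmod z * cmod y.
Proof. by apply: cmod_inj; rewrite rmorphM /= -!cmodE normrM. Qed.

Lemma cmodV z : cmod z^-1 = (cmod z)^-1.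
Proof. by apply: cmod_inj; rewrite fmorphV /= -!cmodE normfV. Qed.

Lemma cmodX z n : cmod (z ^+ n) = cmod z ^+ n.
Proof. by apply: cmod_inj; rewrite rmorphXn /= -!cmodE normrX. Qed.

Lemma cmod_sign n : cmod ((-1) ^+ n) = 1.
Proof. by rewrite cmodX cmodN cmod1 expr1n. Qed.

Lemma cmod_nat n : cmod n%:R = n%:R.
Proof. by apply: cmod_inj; rewrite -cmodE normr_nat rmorph_nat. Qed.

Lemma cmodD z y : cmod (z + y) <= cmod z + cmod y.
Proof. by rewrite -lecR rmorphD /= -!cmodE ler_normD. Qed.

Lemma cmodB z y : cmod (z - y) <= cmod z + cmod y.
Proof. by rewrite (le_trans (cmodD _ _)) // cmodN. Qed.

Lemma cmod_sum (I : Type) (s : seq I) (P : pred I) (F : I -> Cx R) :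
  cmod (\sum_(i <- s | P i) F i) <= \sum_(i <- s | P i) cmod (F i).
Proof.
elim/big_ind2 : _ => [|x1 x2 y1 y2 h1 h2|//]; first by rewrite cmod0.
by rewrite (le_trans (cmodD _ _)) // lerD.
Qed.

Lemma cmod_sqrt z : cmod z = Num.sqrt (complex.Re z ^+ 2 + complex.Im z ^+ 2).
Proof. by apply: cmod_inj; rewrite -cmodE normc_def. Qed.

Lemma ReIm_le_cmod z : `|complex.Re z| <= cmod z /\ `|complex.Im z| <= cmod z.
Proof.
by rewrite cmod_sqrt -!sqrtr_sqr !ler_wsqrtr ?lerDl ?lerDr ?sqr_ge0.
Qed.

Lemma cmod_le_ReIm z : cmod z <= `|complex.Re z| + `|complex.Im z|.
Proof.
have h : 0 <= `|complex.Re z| + `|complex.Im z| by rewrite addr_ge0.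
rewrite cmod_sqrt -(ger0_norm h) -(sqrtr_sqr (_ + _)) ler_wsqrtr //.
rewrite sqrrD !real_normK ?num_real // lerD2r lerDl.
by rewrite mulrn_wge0 // mulr_ge0.
Qed.

Lemma ReIm_sum (x : nat -> Cx R) n :
  complex.Re (\sum_(r < n) x r) = series (fun n => complex.Re (x n)) n /\
  complex.Im (\sum_(r < n) x r) = series (fun n => complex.Im (x n)) n.
Proof.
elim: n => [|n [IH1 IH2]]; first by rewrite /series /= !big_ord0 !big_nil.
rewrite /series /= in IH1 IH2 *; rewrite !big_ord_recr !big_nat_recr //=.
by rewrite -IH1 -IH2; case: (\sum_(r < n) x r) (x n) => [a b] [c d].
Qed.

Lemma cmod_cvg0 u (l : Cx R) : (fun n => cmod (u n - l)) @ \oo --> (0 : R) -> u @ \oo --> l.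
Proof.
move=> h; apply/cvgrPdist_lt => e e0.
have e1 : 0 < complex.Re e.
  by rewrite -ltcR RRe_real // gtr0_real.
move/cvgrPdist_lt: h => /(_ _ e1) h; near=> n.
rewrite distrC cmodE -[X in _ < X]RRe_real ?gtr0_real // ltcR.
have : `|0 - cmod (u n - l)| < complex.Re e by near: n.
by rewrite sub0r normrN ger0_norm // cmod_ge0.
Unshelve. all: by end_near. Qed.

Lemma cvg_cmod0 u (l : Cx R) : u @ \oo --> l -> (fun n => cmod (u n - l)) @ \oo --> (0 : R).
Proof.
move=> h; apply/cvgrPdist_lt => e e0.
have e1 : 0 < (e%:C)%C :> Cx R by rewrite ltcR.
move/cvgrPdist_lt: h => /(_ _ e1) h; near=> n.
rewrite sub0r normrN ger0_norm ?cmod_ge0 // -ltcR -cmodE distrC.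
by near: n.
Unshelve. all: by end_near. Qed.

Lemma cmod_squeeze u v (l : Cx R) (e : nat -> R) : v @ \oo --> l ->
  (forall n, cmod (u n - v n) <= e n) -> e @ \oo --> (0 : R) -> u @ \oo --> l.
Proof.
move=> hv huv he; apply: cmod_cvg0.
have h : (fun n => e n + cmod (v n - l)) @ \oo --> (0 : R).
  by rewrite -[0]addr0; apply: cvgD => //; apply: cvg_cmod0.
apply: (squeeze_cvgr _ (cvg_cst (0 : R)) h).
near=> n; rewrite cmod_ge0 /= (_ : u n - l = (u n - v n) + (v n - l)); last by ring.
by rewrite (le_trans (cmodD _ _)) // lerD2r.
Unshelve. all: by end_near. Qed.

Lemma cmod_geometric_cvg (x : nat -> Cx R) (B t : R) : 0 <= t < 1 ->
  (forall n, cmod (x n) <= B * t ^+ n) ->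
  exists l : Cx R, (fun n => \sum_(r < n) x r) @ \oo --> l.
Proof.
move=> /andP[t0 t1] hx.
have geo : cvgn (series (geometric B t)).
  by apply: is_cvg_geometric_series; rewrite ger0_norm.
have real_cvg (y : nat -> R) : (forall n, `|y n| <= B * t ^+ n) ->
    exists l : R, series y @ \oo --> l.
  move=> hy; exists (limn (series y)).
  apply: normed_cvg; apply: series_le_cvg geo => n /=; [exact: normr_ge0| |exact: hy].
  exact: le_trans (normr_ge0 _) (hy n).
have [a ha] : exists l : R, series (fun n => complex.Re (x n)) @ \oo --> l.
  by apply: real_cvg => n; apply: le_trans (hx n); have [] := ReIm_le_cmod (x n).
have [b hb] : exists l : R, series (fun n => complex.Im (x n)) @ \oo --> l.
  by apply: real_cvg => n; apply: le_trans (hx n); have [] := ReIm_le_cmod (x n).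
exists (a +i* b)%C; apply: cmod_cvg0.
have dist0 (w : nat -> R) (c : R) : w @ \oo --> c ->
    (fun n => `|w n - c|) @ \oo --> (0 : R).
  by move=> hw; rewrite -(normr0 R) -(subrr c); apply: cvg_norm; apply: cvgB => //; apply: cvg_cst.
have h : (fun n => `|series (fun n => complex.Re (x n)) n - a|
       + `|series (fun n => complex.Im (x n)) n - b|) @ \oo --> (0 : R).
  by rewrite -[0]addr0; apply: cvgD; apply: dist0.
apply: (squeeze_cvgr _ (cvg_cst (0 : R)) h).
near=> n; rewrite cmod_ge0 /=.
have [<- <-] := ReIm_sum x n; rewrite (le_trans (cmod_le_ReIm _)) //.
by case: (\sum_(r < n) x r).
Unshelve. all: by end_near. Qed.
End ComplexModulus.
Arguments cmod {R} z.

Lemma sum_geometric_le (R : realType) (t : R) n : 0 <= t < 1 ->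
  \sum_(k < n) t ^+ k <= (1 - t)^-1.
Proof.
move=> /andP[t0 t1]; have h : 0 < 1 - t by rewrite subr_gt0.
rewrite -[leRHS]mul1r ler_pdivlMr // (_ : _ * _ = 1 - t ^+ n).
  by rewrite gerBl exprn_ge0.
by rewrite -[RHS]opprB subrX1; ring.
Qed.

(** Factorwise 1 + x <= exp x, which leaves a geometric series in the exponent. *)
Lemma prod_geometric_bounded (R : realType) (a t : R) : 0 <= a -> 0 <= t < 1 ->
  exists B, forall n, \prod_(k < n) (1 + a * t ^+ k) <= B.
Proof.
move=> a0 ht; exists (expR (a / (1 - t))) => n; have /andP[t0 _] := ht.
apply: (@le_trans _ _ (expR (a * \sum_(k < n) t ^+ k))); last first.
  by rewrite ler_expR ler_wpM2l // sum_geometric_le.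
elim: n => [|n IH]; first by rewrite !big_ord0 mulr0 expR0.
rewrite !big_ord_recr /= [a * (_ + _)]mulrDr expRD ler_pM ?expR_ge1Dx //.
  by apply: prodr_ge0 => k _; rewrite addr_ge0 // mulr_ge0 // exprn_ge0.
by rewrite addr_ge0 // mulr_ge0 // exprn_ge0.
Qed.

Lemma cmod_prod_bounded (R : realType) (f : nat -> Cx R) (a t : R) :
  0 <= a -> 0 <= t < 1 -> (forall k, cmod (f k) <= 1 + a * t ^+ k) ->
  exists B, forall n, cmod (\prod_(0 <= k < n) f k) <= B.
Proof.
move=> a0 ht hf; have [B hB] := prod_geometric_bounded _ a t a0 ht.
exists B => n; apply: le_trans (hB n); rewrite big_mkord.
elim: n => [|n IH]; first by rewrite !big_ord0 cmod1.
by rewrite !big_ord_recr /= cmodM ler_pM ?cmod_ge0.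
Qed.

(** * Uniform estimates and limits of the partial sums *)

Section Asymptotics.
Variables (R : realType) (Q : Cx R).
Hypothesis Q_neq0 : Q != 0.
Let t := cmod Q.
Hypothesis t_lt1 : t < 1.

Let t0 : 0 <= t. Proof. exact: cmod_ge0. Qed.
Let t01 : 0 <= t < 1. Proof. by rewrite t0 t_lt1. Qed.
Let gap : 0 < 1 - t. Proof. by rewrite subr_gt0. Qed.
Let gap_inv : 0 <= (1 - t)^-1. Proof. by rewrite invr_ge0 ltW. Qed.

Lemma cmod_lt1_nroot n : 1 - Q ^+ n.+1 != 0.
Proof.
rewrite subr_eq0; apply/negP => /eqP /(congr1 cmod).
rewrite cmod1 cmodX => /eqP; rewrite eq_sym lt_eqF //.
by rewrite exprn_ilt1.
Qed.

Let tX_le m n : (m <= n)%N -> t ^+ n <= t ^+ m.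
Proof. by move=> h; rewrite ler_wiXn2l // ltW. Qed.

Let cmod_1B n : cmod (1 - Q ^+ n) <= 1 + t ^+ n.
Proof. by rewrite (le_trans (cmodB _ _ _)) // cmod1 cmodX. Qed.

(** For 0 <= x <= t one has 1 / (1 - x) <= 1 + x / (1 - t), a bound of the form required for
    products. *)
Let inv_1B n : (cmod (1 - Q ^+ n.+1))^-1 <= 1 + (1 - t)^-1 * t ^+ n.
Proof.
have tn0 : 0 <= t ^+ n.+1 by rewrite exprn_ge0.
have tn : t ^+ n.+1 <= t by rewrite -[leRHS]expr1 tX_le.
have h1 : 1 - t ^+ n.+1 <= cmod (1 - Q ^+ n.+1).
  rewrite lerBlDr -cmodX -[leLHS]cmod1 -{1}(subrK (Q ^+ n.+1) 1).
  exact: cmodD.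
have h2 : 0 < 1 - t ^+ n.+1 by rewrite subr_gt0 (le_lt_trans tn).
have h3 : (cmod (1 - Q ^+ n.+1))^-1 <= (1 - t ^+ n.+1)^-1.
  by rewrite lef_pV2 // posrE // (lt_le_trans h2).
apply: (le_trans h3); apply: (@le_trans _ _ (1 + (1 - t)^-1 * t ^+ n.+1)).
  rewrite -[leLHS]mul1r ler_pdivrMr //; move: (t ^+ n.+1) tn0 tn h2 => x tn0 tn h2.
  rewrite [leRHS](_ : _ = 1 + (1 - t)^-1 * (x * (t - x))); last by field; rewrite gt_eqF.
  by rewrite lerDl !mulr_ge0 // subr_ge0.
by rewrite lerD2l ler_wpM2l ?tX_le.
Qed.

Lemma qpoch_bounded : exists B : R, [/\ 1 <= B,
  forall n, cmod (qpoch Q Q n) <= B, forall n, cmod (qpoch Q Q n)^-1 <= B,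
  forall n, cmod (qpoch (-1) Q n) <= B &
  forall n, cmod (qpoch (Q ^+ 2) (Q ^+ 2) n) <= B].
Proof.
have b1 k : cmod (1 - Q * Q ^+ k) <= 1 + 1 * t ^+ k.
  by rewrite -exprS mul1r (le_trans (cmod_1B _)) // lerD2l tX_le.
have b2 k : cmod (1 - Q * Q ^+ k)^-1 <= 1 + (1 - t)^-1 * t ^+ k.
  by rewrite -exprS cmodV inv_1B.
have b3 k : cmod (1 - (-1) * Q ^+ k) <= 1 + 1 * t ^+ k.
  by rewrite mul1r mulN1r (le_trans (cmodB _ _ _)) // cmodN cmodX cmod1.
have b4 k : cmod (1 - Q ^+ 2 * (Q ^+ 2) ^+ k) <= 1 + 1 * t ^+ k.
  rewrite -exprS -exprM mul1r (le_trans (cmod_1B _)) // lerD2l tX_le //; lia.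
have [B1 h1] := cmod_prod_bounded _ _ _ _ ler01 t01 b1.
have [B2 h2] := cmod_prod_bounded _ _ _ _ gap_inv t01 b2.
have [B3 h3] := cmod_prod_bounded _ _ _ _ ler01 t01 b3.
have [B4 h4] := cmod_prod_bounded _ _ _ _ ler01 t01 b4.
have p1 : 0 <= B1 := le_trans (cmod_ge0 _ _) (h1 0%N).
have p2 : 0 <= B2 := le_trans (cmod_ge0 _ _) (h2 0%N).
have p3 : 0 <= B3 := le_trans (cmod_ge0 _ _) (h3 0%N).
have p4 : 0 <= B4 := le_trans (cmod_ge0 _ _) (h4 0%N).
exists (1 + B1 + B2 + B3 + B4); split => [|n|n|n|n].
- by lra.
- by have := h1 n; rewrite /qpoch; lra.
- have := h2 n; rewrite prodfV /qpoch; lra.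
- by have := h3 n; rewrite /qpoch; lra.
- by have := h4 n; rewrite /qpoch; lra.
Qed.

Section Limits.
Variable w : Cx R.
Hypothesis w_spec : w = 1 \/ w = Q.

(** For w = Q the term i = r equals Q^(-r), hence the normalisation by Q^r; the i-th term is then at
    most t^(r-i). *)
Lemma theta_bounded r : cmod (Q ^+ r * theta _ Q w r) <= (1 - t)^-1.
Proof.
rewrite /theta mulr_sumr (le_trans (cmod_sum _ _ _ _ _)) //.
apply: le_trans (sum_geometric_le _ t r.+1 t01).
rewrite [leRHS](reindex_inj rev_ord_inj) /=; apply: ler_sum => -[i hi] _ /=.
rewrite subSS; have hir : (i <= r)%N by [].
have h : cmod (Q ^+ r * w ^+ (r - i) * w ^- i) <= t ^+ (r - i).
  case: w_spec => ->.
    by rewrite !expr1n invr1 !mulr1 cmodX tX_le // leq_subr.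
  have -> : Q ^+ r * Q ^+ (r - i) / Q ^+ i = Q ^+ (r - i + (r - i)).
    by rewrite -{1}(subnK hir) !exprD; field; rewrite expf_neq0.
  by rewrite cmodX tX_le // leq_addr.
rewrite (_ : _ * _ = Q ^+ (2 * i * (r - i)) * (Q ^+ r * w ^+ (r - i) * w ^- i)); last by ring.
rewrite cmodM cmodX -[leRHS]mul1r ler_pM ?cmod_ge0 ?exprn_ge0 //.
by rewrite exprn_ile1 // ltW.
Qed.

Let nroot := cmod_lt1_nroot.

(** By [kappa_rec] the errors satisfy e_(r+1) <= t e_r + A t^N, and A / (1 - t) is the fixed point
    of x = t x + A, which gives a bound uniform in r. *)
Lemma kappa_limit : exists B : R, 0 <= B /\ forall r N,
  cmod (kappa _ Q r N - 2 * (-1) ^+ r * Q ^+ r.+1) <= B * t ^+ N.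
Proof.
have [B [B1 hP hPi hD _]] := qpoch_bounded.
have B0 : 0 <= B by lra.
have two : 2 = 1 + 1 :> R by [].
pose A := 2 * B * B * B * B.
have hA : 0 <= A by rewrite !mulr_ge0.
have BA : A <= A / (1 - t).
  by rewrite ler_pdivlMr // ler_piMr // gerBl.
exists (A / (1 - t)); split; first by rewrite mulr_ge0.
elim=> [|r IH] N.
  rewrite kappa0 // expr0 mulr1 expr1 addrC addKr.
  apply: (@le_trans _ _ (A * t ^+ N)); last by rewrite ler_wpM2r ?exprn_ge0.
  rewrite !cmodM cmodX cmodN -/t /A.
  have h1 : cmod (1 - Q) <= 2.
    by rewrite (le_trans (cmodB _ _ _)) // cmod1 two lerD2l ltW.
  have h2 : t ^+ N.+1 <= t ^+ N by rewrite tX_le.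
  have h3 : 2 * B * t ^+ N * B <= 2 * B * B * B * B * t ^+ N.
    rewrite [leRHS](_ : _ = (2 * B * t ^+ N * B) * (B * B)); last by ring.
    by rewrite ler_peMr ?mulr_ge0 ?exprn_ge0 //; nra.
  by apply: le_trans h3; rewrite !ler_pM ?mulr_ge0 ?cmod_ge0 ?exprn_ge0.
rewrite (_ : _ - _ = - Q * (kappa _ Q r N - 2 * (-1) ^+ r * Q ^+ r.+1)
   + (kappa _ Q r.+1 N + Q * kappa _ Q r N)); last by rewrite !exprS; ring.
rewrite (kappa_rec _ Q Q_neq0 nroot w w_spec).
have hr : cmod (rinv _ Q N r.+1) <= B.
  by rewrite /rinv; case: ifP => _; rewrite ?cmod0.
have h1 : cmod (1 - Q ^+ (2 * r + 3)) <= 2.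
  by rewrite (le_trans (cmod_1B _)) // two lerD2l exprn_ile1 // ltW.
have h2 : t ^+ N.+1 <= t ^+ N by rewrite tX_le.
rewrite (le_trans (cmodD _ _ _)) // cmodM cmodN.
have -> : A / (1 - t) * t ^+ N = t * (A / (1 - t) * t ^+ N) + A * t ^+ N.
  by field; rewrite gt_eqF.
apply: lerD; first by rewrite ler_wpM2l.
rewrite !cmodM cmod_sign mul1r cmodX.
rewrite (_ : A * t ^+ N = 2 * t ^+ N * B * B * B * B); last by rewrite /A; ring.
by rewrite !ler_pM ?mulr_ge0 ?cmod_ge0 ?exprn_ge0.
Qed.

Let cvg_geo (B : R) : (fun N => B * t ^+ N) @ \oo --> (0 : R).
Proof. by apply: cvg_geometric; rewrite ger0_norm. Qed.

Lemma ebase_sub_bounded : exists B : R, 0 <= B /\ forall n b, (b <= n.+1)%N ->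
  cmod (ebase _ Q n.+1 b - ebase _ Q n b) <= B * t ^+ (n.+1 - b).
Proof.
have [B [B1 hP hPi hD hP2]] := qpoch_bounded.
have B0 : 0 <= B by lra.
exists (B * B * B * (1 + 1 + 2)); split; first by rewrite !mulr_ge0.
move=> n b hb; rewrite ebase_sub // -mulrA.
have hr : cmod (rinv _ Q n.+1 b) <= B.
  by rewrite /rinv; case: ifP => _; rewrite ?cmod0.
have h1 : t ^+ (n.+1 + b) <= t ^+ (n.+1 - b) by rewrite tX_le //; lia.
have h2 : t ^+ n.+1 * t ^+ n.+1 <= t ^+ (n.+1 - b).
  by rewrite -exprD tX_le //; lia.
rewrite -mulrA -[leRHS]mulrA -[leRHS]mulrA -[leRHS]mulrA !cmodM.
apply: ler_pM; rewrite ?cmod_ge0 ?mulr_ge0 ?cmod_ge0 //.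
apply: ler_pM; rewrite ?cmod_ge0 ?mulr_ge0 ?cmod_ge0 //.
apply: ler_pM; rewrite ?cmod_ge0 //.
rewrite (le_trans (cmodB _ _ _)) // [(1 + 1 + 2) * _]mulrDl [(1 + 1) * _]mulrDl !mul1r lerD //.
  by rewrite (le_trans (cmodD _ _ _)) // !cmodX lerD.
by rewrite -mulrA cmodM cmod_nat [leLHS]mulr_natl mulr2n cmodM !cmodX lerD.
Qed.

(** Adding the values at 2N and 2N + 1 leaves only differences of consecutive [ebase]. The bound
    worsens by t^(-r), which the Gaussian factor Q^(r^2) later absorbs. *)
Lemma gamma_limit : exists B : R, 0 <= B /\ forall N r, (r <= (2 * N).+2)%N ->
  cmod (gamma _ Q r (2 * N) + gamma _ Q r (2 * N).+1 - (-1) ^+ r)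
  <= B * t ^+ ((2 * N).+2 - r).
Proof.
have [A [A0 hA]] := ebase_sub_bounded.
have BA : A <= A / (1 - t).
  by rewrite ler_pdivlMr // ler_piMr // gerBl.
exists (A / (1 - t)); split; first by rewrite mulr_ge0.
move=> N; elim=> [|r IH] hr.
  have h : 2 * (gamma _ Q 0 (2 * N) + gamma _ Q 0 (2 * N).+1 - (-1) ^+ 0)
      = - (ebase _ Q (2 * N).+2 0 - ebase _ Q (2 * N).+1 0).
    rewrite expr0 mulrBr mulrDr !gamma0 // exprS [(-1) ^+ (2 * N)]exprM sqrrN expr1n expr1n.
    by ring.
  have := hA (2 * N).+1 0%N (leq0n _); rewrite -cmodN -h cmodM cmod_nat => h2.
  apply: (@le_trans _ _ (A * t ^+ ((2 * N).+2 - 0))).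
    by apply: le_trans h2; rewrite ler_peMl ?cmod_ge0 // ler1n.
  by rewrite ler_wpM2r ?exprn_ge0.
have -> : gamma _ Q r.+1 (2 * N) + gamma _ Q r.+1 (2 * N).+1 - (-1) ^+ r.+1 =
    - (gamma _ Q r (2 * N) + gamma _ Q r (2 * N).+1 - (-1) ^+ r)
    - (ebase _ Q (2 * N).+2 r.+1 - ebase _ Q (2 * N).+1 r.+1).
  have s2N : (-1) ^+ (2 * N) = 1 :> Cx R by rewrite exprM sqrrN expr1n expr1n.
  have h1 := gamma_rec _ Q nroot r (2 * N).
  have h2 := gamma_rec _ Q nroot r (2 * N).+1.
  rewrite exprS s2N in h2; rewrite s2N in h1.
  have -> : ebase _ Q (2 * N).+2 r.+1 =
      - (gamma _ Q r (2 * N).+1 + gamma _ Q r.+1 (2 * N).+1) by rewrite h2; ring.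
  have -> : ebase _ Q (2 * N).+1 r.+1 =
      gamma _ Q r (2 * N) + gamma _ Q r.+1 (2 * N) by rewrite h1; ring.
  by rewrite exprS; ring.
rewrite (le_trans (cmodB _ _ _)) // cmodN.
have e : ((2 * N).+2 - r = ((2 * N).+2 - r.+1).+1)%N by lia.
have := IH (ltnW hr); have := hA (2 * N).+1 r.+1 hr; rewrite e exprS.
move: (t ^+ _) => x h1 h2; apply: (le_trans (lerD h2 h1)).
rewrite [leLHS](_ : _ = A / (1 - t) * x) //; by field; rewrite gt_eqF.
Qed.

Lemma theta_expr_bounded r m : (r <= m)%N ->
  cmod (Q ^+ m * theta _ Q w r) <= (1 - t)^-1 * t ^+ (m - r).
Proof.
move=> h; rewrite -{1}(subnK h) exprD -mulrA cmodM cmodX mulrC.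
by rewrite ler_wpM2r ?exprn_ge0 // theta_bounded.
Qed.

(** The limit 2 (-1)^r Q^(r+1) of [kappa] cancels the alternating sign and adds r + 1 to the
    exponent. *)
Lemma kappa_sum_cvg : exists l : Cx R,
  (fun N => \sum_(r < N) 2 * (theta _ Q w r * Q ^+ (r.+1 ^ 2 + r.+1))) @ \oo --> l /\
  (fun N => \sum_(r < N) (-1) ^+ r * theta _ Q w r * Q ^+ (r.+1 ^ 2) * kappa _ Q r N)
     @ \oo --> l.
Proof.
have [|l hl] := cmod_geometric_cvg _
  (fun r => 2 * (theta _ Q w r * Q ^+ (r.+1 ^ 2 + r.+1))) (2 * (1 - t)^-1) t t01.
  move=> r; rewrite cmodM cmod_nat -mulrA ler_wpM2l // mulrC.
  apply: le_trans (theta_expr_bounded r _ _) _; first by lia.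
  by rewrite ler_wpM2l // tX_le //; nia.
exists l; split=> //.
have [B [B0 hB]] := kappa_limit.
apply: (cmod_squeeze _ _ _ _ _ hl) (cvg_geo ((1 - t)^-1 * B * (1 - t)^-1)) => N.
rewrite -sumrB (le_trans (cmod_sum _ _ _ _ _)) //.
apply: (@le_trans _ _ (\sum_(r < N) (1 - t)^-1 * B * t ^+ N * t ^+ r)); last first.
  rewrite -mulr_sumr mulrAC ler_wpM2r ?exprn_ge0 //.
  by rewrite ler_wpM2l ?sum_geometric_le // mulr_ge0.
apply: ler_sum => r _.
have -> : (-1) ^+ r * theta _ Q w r * Q ^+ (r.+1 ^ 2) * kappa _ Q r N
    - 2 * (theta _ Q w r * Q ^+ (r.+1 ^ 2 + r.+1))
  = (-1) ^+ r * ((Q ^+ (r.+1 ^ 2) * theta _ Q w r)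
      * (kappa _ Q r N - 2 * (-1) ^+ r * Q ^+ r.+1)).
  have : (-1) ^+ r * (-1) ^+ r = 1 :> Cx R by rewrite -exprMn mulrNN mulr1 expr1n.
  rewrite exprD; move: ((-1) ^+ r) => s hs.
  rewrite !mulrBr; congr (_ - _); first by ring.
  by rewrite -[LHS]mul1r -hs; ring.
rewrite cmodM cmod_sign mul1r cmodM.
rewrite [leRHS](_ : _ = ((1 - t)^-1 * t ^+ r) * (B * t ^+ N)); last by ring.
rewrite ler_pM ?cmod_ge0 //; apply: le_trans (theta_expr_bounded r _ _) _; first by lia.
by rewrite ler_wpM2l // tX_le //; nia.
Qed.

Lemma gamma_sum_cvg : exists l : Cx R,
  (fun N => \sum_(r < N) Q ^+ (r ^ 2 + r) * (theta _ Q w r + theta_shift _ Q w r))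
     @ \oo --> l /\
  (fun N => \sum_(r < (2 * N).+2)
     (-1) ^+ r * Q ^+ (r ^ 2 + r) * (theta _ Q w r + theta_shift _ Q w r)
     * (gamma _ Q r (2 * N) + gamma _ Q r (2 * N).+1)) @ \oo --> l.
Proof.
have hX r : cmod (Q ^+ (r ^ 2 + r) * (theta _ Q w r + theta_shift _ Q w r))
    <= 2 * (1 - t)^-1 * t ^+ (r ^ 2).
  rewrite mulrDr (le_trans (cmodD _ _ _)) // -mulrA [2 * _]mulr_natl mulr2n lerD //.
    apply: le_trans (theta_expr_bounded r _ _) _; first by lia.
    by rewrite ler_wpM2l // tX_le //; lia.
  case: r => [|r]; rewrite /theta_shift.
    by rewrite mulr0 cmod0 mulr_ge0 // exprn_ge0.
  rewrite mulrA -exprD; apply: le_trans (theta_expr_bounded r _ _) _; first by lia.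
  by rewrite ler_wpM2l // tX_le //; lia.
have [|l hl] := cmod_geometric_cvg _
  (fun r => Q ^+ (r ^ 2 + r) * (theta _ Q w r + theta_shift _ Q w r)) (2 * (1 - t)^-1) t t01.
  move=> r; apply: le_trans (hX r) _; rewrite ler_wpM2l ?mulr_ge0 // tX_le //; nia.
exists l; split=> //.
have [B [B0 hB]] := gamma_limit.
(* The subsequence of indices 2N + 2, matching the range of r in the averaged sums. *)
have hl2 : (fun N => \sum_(r < (2 * N).+2)
    Q ^+ (r ^ 2 + r) * (theta _ Q w r + theta_shift _ Q w r)) @ \oo --> l.
  move=> S /hl [n _ hn]; exists n => // m /= hm; apply: hn => /=; lia.
apply: (cmod_squeeze _ _ _ _ _ hl2) (cvg_geo (2 * (1 - t)^-1 * B * (1 - t)^-1)) => N.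
rewrite -sumrB (le_trans (cmod_sum _ _ _ _ _)) //.
apply: (@le_trans _ _ (\sum_(r < (2 * N).+2) 2 * (1 - t)^-1 * B * t ^+ N * t ^+ r)); last first.
  rewrite -mulr_sumr mulrAC ler_wpM2r ?exprn_ge0 //.
  by rewrite ler_wpM2l ?sum_geometric_le // !mulr_ge0.
apply: ler_sum => -[r hr] _ /=.
have -> : (-1) ^+ r * Q ^+ (r ^ 2 + r) * (theta _ Q w r + theta_shift _ Q w r)
     * (gamma _ Q r (2 * N) + gamma _ Q r (2 * N).+1)
    - Q ^+ (r ^ 2 + r) * (theta _ Q w r + theta_shift _ Q w r)
  = (-1) ^+ r * ((Q ^+ (r ^ 2 + r) * (theta _ Q w r + theta_shift _ Q w r))
      * (gamma _ Q r (2 * N) + gamma _ Q r (2 * N).+1 - (-1) ^+ r)).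
  have : (-1) ^+ r * (-1) ^+ r = 1 :> Cx R by rewrite -exprMn mulrNN mulr1 expr1n.
  move: (_ + theta_shift _ _ _ _) => T; move: ((-1) ^+ r) => s hs.
  rewrite !mulrBr; congr (_ - _); first by ring.
  by rewrite -[LHS]mul1r -hs; ring.
rewrite cmodM cmod_sign mul1r cmodM.
apply: le_trans (ler_pM (cmod_ge0 _ _) (cmod_ge0 _ _) (hX r) (hB N r (ltnW hr))) _.
rewrite [leLHS](_ : _ = 2 * (1 - t)^-1 * B * t ^+ (r ^ 2 + ((2 * N).+2 - r))); last first.
  by rewrite exprD; ring.
rewrite -[leRHS]mulrA -exprD ler_wpM2l ?mulr_ge0 // tX_le //; nia.
Qed.
End Limits.
End Asymptotics.

(** * The four series expressed through theta functions *)

Lemma L5_partialE (C : numClosedFieldType) (Q : C) N : Q != 0 -> L5_partial Q N =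
  \sum_(m < N) \sum_(j < m.+1) qpoch (-1) Q m.+1 * qpoch Q Q m * (-1) ^+ (m + j)
     * (Q ^+ (m.+1 + j.+1 ^ 2) * Q ^- j)
     / (qpoch Q Q (m - j) * qpoch (Q ^+ 2) (Q ^+ 2) j * (1 - Q ^+ (2 * j + 1))).
Proof.
move=> Q0; rewrite /L5_partial big_add1 big_mkord mulr_sumr; apply: eq_bigr => m _.
rewrite big_add1 big_mkord mulr_sumr; apply: eq_bigr => -[j hj] _ /=.
(* The prefactor of L_5 absorbs the shift k = j + 1, turning Q^(-k) into w^(-j) with w = Q. *)
have -> : Q ^+ (m.+1 + j.+1 ^ 2) * Q ^- j = Q * Q ^+ (m.+1 + j.+1 ^ 2 - j.+1).
  apply: (mulIf (expf_neq0 j Q0)); rewrite divfK ?expf_neq0 // -exprS -exprD.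
  by congr (_ ^+ _); nia.
rewrite /L5_term /= subSS (_ : 2 * j.+1 - 1 = 2 * j + 1)%N; last by lia.
by rewrite [(m.+1 + j.+1)%N]addSn [(m + j.+1)%N]addnS [(-1) ^+ _.+2]exprS [(-1) ^+ _.+1]exprS; ring.
Qed.

Lemma L6_partialE (C : numClosedFieldType) (Q : C) N : L6_partial Q N =
  \sum_(m < N) \sum_(j < m.+1) qpoch (-1) Q m.+1 * qpoch Q Q m * (-1) ^+ (m + j)
     * (Q ^+ (m.+1 + j.+1 ^ 2) * 1 ^- j)
     / (qpoch Q Q (m - j) * qpoch (Q ^+ 2) (Q ^+ 2) j * (1 - Q ^+ (2 * j + 1))).
Proof.
rewrite /L6_partial big_add1 big_mkord; apply: eq_bigr => m _.
rewrite big_add1 big_mkord; apply: eq_bigr => -[j hj] _ /=.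
rewrite /L6_term /= subSS (_ : 2 * j.+1 - 1 = 2 * j + 1)%N; last by lia.
by rewrite expr1n invr1 mulr1 [(m.+1 + j.+1)%N]addSn [(m + j.+1)%N]addnS [(-1) ^+ _.+2]exprS [(-1) ^+ _.+1]exprS; ring.
Qed.

Lemma L7_innerE (C : numClosedFieldType) (Q : C) n : L7_inner Q n =
  \sum_(k < n.+1) qpoch (Q ^+ 2) (Q ^+ 2) n * (-1) ^+ (n + k)
     * (Q ^+ (k ^ 2 + k) * 1 ^- k)
     / (qpoch Q Q (n - k) * qpoch (Q ^+ 2) (Q ^+ 2) k * (1 - Q ^+ (2 * k + 1))).
Proof.
rewrite /L7_inner big_mkord; apply: eq_bigr => k _.
by rewrite expr1n invr1 mulr1.
Qed.

Lemma L8_innerE (C : numClosedFieldType) (Q : C) n : Q != 0 -> L8_inner Q n =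
  \sum_(k < n.+1) qpoch (Q ^+ 2) (Q ^+ 2) n * (-1) ^+ (n + k)
     * (Q ^+ (k ^ 2 + k) * Q ^- k)
     / (qpoch Q Q (n - k) * qpoch (Q ^+ 2) (Q ^+ 2) k * (1 - Q ^+ (2 * k + 1))).
Proof.
move=> Q0; rewrite /L8_inner big_mkord; apply: eq_bigr => k _.
by rewrite [Q ^+ (k ^ 2 + k)]exprD mulfK ?expf_neq0.
Qed.

Lemma star_partialE (C : numClosedFieldType) (c : nat -> C) N :
  2 * star_partial c N = \sum_(n < (2 * N).+1) c n + \sum_(n < (2 * N).+2) c n.
Proof.
by rewrite /star_partial addn1 !big_mkord mulrA mulfV ?mul1r // pnatr_eq0.
Qed.

Lemma cvg_eq1 (R : realType) (u v : nat -> Cx R) (l : Cx R) :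
  u =1 v -> v @ \oo --> l -> u @ \oo --> l.
Proof. by move=> /funext ->. Qed.

Section GeneratingFunctions.
Variables (R : realType) (Q : Cx R).
Hypotheses (Q_neq0 : Q != 0) (Q_lt1 : cmod Q < 1).
Let nroot := cmod_lt1_nroot R Q Q_lt1.

Lemma L5_cvg : exists l : Cx R, L5_partial Q @ \oo --> l /\
  (fun N => \sum_(r < N) 2 * (theta _ Q Q r * Q ^+ (r.+1 ^ 2 + r.+1))) @ \oo --> l.
Proof.
have hw : Q = 1 \/ Q = Q by right.
have [l [h1 h2]] := kappa_sum_cvg _ _ Q_neq0 Q_lt1 _ hw.
exists l; split => //; apply: cvg_eq1 h2 => N.
by rewrite L5_partialE // double_sum_kappa.
Qed.

Lemma L6_cvg : exists l : Cx R, L6_partial Q @ \oo --> l /\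
  (fun N => \sum_(r < N) 2 * (theta _ Q 1 r * Q ^+ (r.+1 ^ 2 + r.+1))) @ \oo --> l.
Proof.
have hw : (1 : Cx R) = 1 \/ 1 = Q by left.
have [l [h1 h2]] := kappa_sum_cvg _ _ Q_neq0 Q_lt1 _ hw.
exists l; split => //; apply: cvg_eq1 h2 => N.
by rewrite L6_partialE double_sum_kappa.
Qed.

Lemma star_sum_gamma (w : Cx R) (c : nat -> Cx R) N : w = 1 \/ w = Q ->
  (forall n, c n = \sum_(k < n.+1) qpoch (Q ^+ 2) (Q ^+ 2) n * (-1) ^+ (n + k)
     * (Q ^+ (k ^ 2 + k) * w ^- k)
     / (qpoch Q Q (n - k) * qpoch (Q ^+ 2) (Q ^+ 2) k * (1 - Q ^+ (2 * k + 1)))) ->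
  2 * star_partial c N = \sum_(r < (2 * N).+2)
     (-1) ^+ r * Q ^+ (r ^ 2 + r) * (theta _ Q w r + theta_shift _ Q w r)
     * (gamma _ Q r (2 * N) + gamma _ Q r (2 * N).+1).
Proof.
move=> hw hc; rewrite star_partialE.
under eq_bigr => n _ do rewrite hc.
rewrite (double_sum_gamma _ Q Q_neq0 nroot w hw (2 * N) (2 * N).+2) //.
under [X in _ + X]eq_bigr => n _ do rewrite hc.
rewrite (double_sum_gamma _ Q Q_neq0 nroot w hw (2 * N).+1 (2 * N).+2) //.
by rewrite -big_split; apply: eq_bigr => r _; rewrite [RHS]mulrDr.
Qed.

Lemma L7_cvg : exists l : Cx R, L7_partial Q @ \oo --> l /\
  (fun N => \sum_(r < N) Q ^+ (r ^ 2 + r) * (theta _ Q 1 r + theta_shift _ Q 1 r))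
     @ \oo --> l.
Proof.
have hw : (1 : Cx R) = 1 \/ 1 = Q by left.
have [l [h1 h2]] := gamma_sum_cvg _ _ Q_neq0 Q_lt1 _ hw.
exists l; split => //; apply: cvg_eq1 h2 => N.
by apply: star_sum_gamma => // n; apply: L7_innerE.
Qed.

Lemma L8_cvg : exists l : Cx R, L8_partial Q @ \oo --> l /\
  (fun N => -1 + \sum_(r < N) Q ^+ (r ^ 2 + r) * (theta _ Q Q r + theta_shift _ Q Q r))
     @ \oo --> l.
Proof.
have hw : Q = 1 \/ Q = Q by right.
have [l [h1 h2]] := gamma_sum_cvg _ _ Q_neq0 Q_lt1 _ hw.
have hc : (fun _ : nat => -1 : Cx R) @ \oo --> (-1 : Cx R) by exact: cvg_cst.
exists (-1 + l); split; last exact: (cvg_eq1 _ _ _ _ _ (cvgD hc h1)).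
apply: (cvg_eq1 _ _ _ _ _ (cvgD hc h2)) => N; rewrite /L8_partial.
by rewrite (star_sum_gamma Q (L8_inner Q) N hw) // => n; apply: L8_innerE.
Qed.
End GeneratingFunctions.

(** With s = t^(1/4), n s^n is at most 1 / (1 - s), and t^n = (s^n)^2 (s^2)^n leaves a geometric
    factor. *)
Lemma cvg_sqr_geometric (R : realType) (t : R) : 0 <= t < 1 ->
  (fun n => (n ^ 2)%:R * t ^+ n) @ \oo --> (0 : R).
Proof.
move=> /andP[t0 t1]; pose s := Num.sqrt (Num.sqrt t).
have s0 : 0 <= s := sqrtr_ge0 _.
have es : s ^+ 4 = t by rewrite (exprM s 2 2) !sqr_sqrtr ?sqrtr_ge0.
have s1 : s < 1 by rewrite -(@expr_lt1 _ 4) // es.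
have s01 : 0 <= s < 1 by rewrite s0 s1.
have hns n : n%:R * s ^+ n <= (1 - s)^-1.
  apply: le_trans (sum_geometric_le _ _ n s01).
  rewrite -[n in n%:R]card_ord mulr_natl -sumr_const; apply: ler_sum => i _.
  by rewrite ler_wiXn2l ?(ltW s1) // ltnW.
have h : (fun n => (1 - s)^-1 ^+ 2 * (s ^+ 2) ^+ n) @ \oo --> (0 : R).
  apply: cvg_geometric; rewrite ger0_norm ?exprn_ge0 //.
  by rewrite exprn_ilt1.
apply: (squeeze_cvgr _ (cvg_cst (0 : R)) h); near=> n.
have -> : t ^+ n = (s ^+ n) ^+ 2 * (s ^+ 2) ^+ n.
  by rewrite -es -!exprM -exprD; congr (_ ^+ _); lia.
rewrite !mulr_ge0 ?exprn_ge0 //= mulrA ler_wpM2r ?exprn_ge0 // natrX -exprMn.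
apply: lerXn2r (hns n); rewrite nnegrE ?mulr_ge0 ?exprn_ge0 //.
by rewrite invr_ge0 subr_ge0 ltW.
Unshelve. all: by end_near. Qed.

(** * Ideal series as sums over lattice points *)

Section IdealSeries.
Variables (R : realType) (q : Cx R).
Hypothesis q_lt1 : cmod q < 1.
Variables (P : set OL -> Prop) (m r0 : nat) (pt : nat * nat -> OL) (len : nat -> nat).
Hypothesis count_tri : forall n N, (n < N)%N -> (n %% m = r0)%N ->
  ideal_count P n = size [seq p <- tri len N | `|OL_fnorm (pt p)|%N == n].
Hypothesis residue_tri : forall r k, (k < len r)%N ->
  (`|OL_fnorm (pt (r, k))| %% m = r0)%N.
Hypothesis len_le : forall r, (len r <= 2 * r.+1)%N.

Lemma ideal_series_partial_tri N : ideal_series_partial P m r0 q N =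
  \sum_(p <- tri len N | (`|OL_fnorm (pt p)| < N)%N) q ^+ `|OL_fnorm (pt p)|.
Proof.
rewrite /ideal_series_partial big_mkord.
transitivity (\sum_(n < N) \sum_(p <- tri len N)
   if (`|OL_fnorm (pt p)|%N == n) then q ^+ n else 0).
  apply: eq_bigr => n _; rewrite -big_mkcond /= -big_filter big_const_seq count_predT.
  case: eqP => [h|h].
    by rewrite (count_tri n N) // mulr_natl iter_addr_0.
  rewrite (_ : [seq _ <- _ | _] = [::]) //; apply/eqP; rewrite -(negbK (_ == _)) -has_filter.
  apply/negP => /hasP [[r k]]; rewrite mem_tri => /andP[_ hk] /eqP e.
  by apply: h; rewrite -e residue_tri.
rewrite exchange_big /= [RHS]big_mkcond /=; apply: eq_bigr => p _.
case: ltnP => h.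
  rewrite (bigD1 (Ordinal h)) //= eqxx big1 ?addr0 // => i.
  by rewrite -val_eqE /= eq_sym => /negbTE ->.
by rewrite big1 // => i _; rewrite gtn_eqF // (leq_trans _ h).
Qed.

Lemma size_tri_le N : (size (tri len N) <= 2 * N ^ 2)%N.
Proof.
rewrite size_allpairs_dep sumnE !big_map -{1}[N]subn0 big_mkord.
apply: (@leq_trans (\sum_(i < N) 2 * N)); last by rewrite sum_nat_const card_ord; nia.
by apply: leq_sum => i _; rewrite size_iota (leq_trans (len_le i)) // leq_mul2l ltn_ord.
Qed.

(** Truncating by norm and truncating by row differ by at most 2 N^2 points, all of norm at least N,
    hence by at most 2 N^2 |q|^N. *)
Lemma ideal_series_cvg (l : Cx R) :
  (fun N => \sum_(r < N) \sum_(k < len r) q ^+ `|OL_fnorm (pt (val r, val k))|) @ \oo --> l ->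
  ideal_series_partial P m r0 q @ \oo --> l.
Proof.
move=> hl; have t01 : 0 <= cmod q < 1 by rewrite cmod_ge0.
have h2 : (fun n => 2 * ((n ^ 2)%:R * cmod q ^+ n)) @ \oo --> (0 : R).
  by rewrite -(mulr0 2); apply: cvgM; [exact: cvg_cst|exact: cvg_sqr_geometric].
apply: (cmod_squeeze _ _ _ _ _ hl) h2 => N.
have -> : \sum_(r < N) \sum_(k < len r) q ^+ `|OL_fnorm (pt (val r, val k))|
    = \sum_(p <- tri len N) q ^+ `|OL_fnorm (pt p)|.
  rewrite /tri big_allpairs_dep -[X in iota 0 X]subn0 big_mkord; apply: eq_bigr => r _.
  by rewrite -[X in iota 0 X]subn0 big_mkord.
rewrite ideal_series_partial_tri [X in _ - X](bigID (fun p => `|OL_fnorm (pt p)| < N)%N) /=.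
rewrite opprD addrA subrr add0r cmodN.
rewrite (le_trans (cmod_sum _ _ _ _ _)) //.
apply: (@le_trans _ _ (\sum_(p <- tri len N) cmod q ^+ N)).
  rewrite [leRHS](bigID (fun p => `|OL_fnorm (pt p)| < N)%N) /=.
  rewrite -[leLHS]add0r lerD ?sumr_ge0 // => [p _|]; first by rewrite exprn_ge0 ?cmod_ge0.
  apply: ler_sum => p; rewrite -leqNgt cmodX => h.
  by rewrite ler_wiXn2l ?cmod_ge0 // ltW.
rewrite big_const_seq count_predT iter_addr_0 -[leLHS]mulr_natl.
have -> : 2 * ((N ^ 2)%:R * cmod q ^+ N) = (2 * N ^ 2)%:R * cmod q ^+ N.
  by rewrite natrM mulrA.
by rewrite ler_wpM2r ?exprn_ge0 ?cmod_ge0 // ler_nat size_tri_le.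
Qed.
End IdealSeries.

(** * Comparison of the two series *)

Lemma big_ord_double (V : zmodType) r (F : nat -> V) :
  \sum_(k < (2 * r).+1) F k =
  \sum_(i < r.+1) F (2 * i)%N + \sum_(i < r) F (2 * i).+1.
Proof.
elim: r => [|r IH]; first by rewrite !big_ord_recr !big_ord0 /= addr0.
rewrite mulnS [(2 + _)%N]addnC addn2 2!big_ord_recr /= IH.
rewrite [\sum_(i < r.+2) _]big_ord_recr [\sum_(i < r.+1) F _.+1]big_ord_recr /=.
have -> : (2 * r.+1 = (2 * r).+2)%N by lia.
by rewrite [RHS]addrACA -[LHS]addrA; congr (_ + _); rewrite addrC.
Qed.

(** All subtracted terms are moved across, so that exponents can be compared over the naturals. *)
Lemma normz_neg_pt b r k : (k < r.+1)%N ->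
  (`|OL_fnorm (neg_pt b (r, k))| + r ^ 2 + b + 4 * k ^ 2 + 4 * k * b
   = 3 * r.+1 ^ 2 + 4 * r * k + 2 * r * b)%N.
Proof.
move=> h; have := in_cone_fnorm _ (neg_pt_cone b r k h).
by rewrite /OL_fnorm /neg_pt /=; case: b => /=; lia.
Qed.

Lemma normz_pos_pt b r k : (k < (2 * r).+1)%N ->
  (`|OL_fnorm (pos_pt b (r, k))| + 3 * r ^ 2 + 3 * k ^ 2
   = (3 * r + 1 + (odd k (+) b)) ^ 2 + 6 * r * k)%N.
Proof.
move=> h; have := fnorm_pos_mod3 _ (pos_pt_mod3 b r k h).
by rewrite /OL_fnorm /pos_pt /=; move: (nat_of_bool _) => c; lia.
Qed.

Section Exponents.
Variables (C : numClosedFieldType) (q : C).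
Hypothesis q_neq0 : q != 0.

(** Since 4 k (r - k) = r^2 - (r - 2k)^2, the exponent of q on the right is 1 + 3 (r + 1)^2 - (r -
    2k)^2. *)
Lemma theta_neg_pt0 r :
  q * \sum_(k < r.+1) q ^+ `|OL_fnorm (neg_pt false (r, val k))|
  = theta _ (q ^+ 2) 1 r * (q ^+ 2) ^+ (r.+1 ^ 2 + r.+1).
Proof.
rewrite /theta mulr_suml mulr_sumr; apply: eq_bigr => -[k hk] _ /=.
rewrite !expr1n invr1 !mulr1 -exprS -!exprM -exprD; congr (_ ^+ _).
have := normz_neg_pt false r k hk; move: `|_|%N => e.
have hkr : (k <= r)%N by [].
move: (subnKC hkr); move: (r - k)%N => d <-; nia.
Qed.

Lemma theta_neg_pt1 r :
  q ^+ 2 * \sum_(k < r.+1) q ^+ `|OL_fnorm (neg_pt true (r, val k))|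
  = theta _ (q ^+ 2) (q ^+ 2) r * (q ^+ 2) ^+ (r.+1 ^ 2 + r.+1).
Proof.
rewrite /theta mulr_suml mulr_sumr; apply: eq_bigr => -[k hk] _ /=.
apply: (mulIf (expf_neq0 (2 * k) q_neq0)).
rewrite -[in RHS](exprM q 2 k) -!exprM -!exprD [RHS]mulrAC mulfVK ?expf_neq0 //.
rewrite -!exprD; congr (_ ^+ _).
have := normz_neg_pt true r k hk; move: `|_|%N => e.
have hkr : (k <= r)%N by [].
move: (subnKC hkr); move: (r - k)%N => d <-; nia.
Qed.

(** Even k have first coordinate 3r + 1 and give [theta]; odd k have 3r + 2 and give
    [theta_shift]. *)
Lemma theta_pos_pt0 r :
  \sum_(k < (2 * r).+1) q ^+ `|OL_fnorm (pos_pt false (r, val k))|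
  = q * ((q ^+ 6) ^+ (r ^ 2 + r) * (theta _ (q ^+ 6) 1 r + theta_shift _ (q ^+ 6) 1 r)).
Proof.
rewrite (big_ord_double _ r (fun k => q ^+ `|OL_fnorm (pos_pt false (r, k))|)).
rewrite !mulrDr; congr (_ + _).
  rewrite /theta !mulr_sumr; apply: eq_bigr => -[k hk] _ /=.
  rewrite !expr1n invr1 !mulr1 -!exprM -!exprD -exprS; congr (_ ^+ _).
  have hk2 : (2 * k < (2 * r).+1)%N by lia.
  have := normz_pos_pt false r _ hk2; rewrite oddM /=; move: `|_|%N => e.
  have hkr : (k <= r)%N by [].
  move: (subnKC hkr); move: (r - k)%N => d <-; nia.
case: r => [|r]; first by rewrite big_ord0 /theta_shift !mulr0.
rewrite /theta_shift /theta !mulr_sumr; apply: eq_bigr => -[k hk] _ /=.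
rewrite !expr1n invr1 !mulr1 -!exprM -!exprD -exprS; congr (_ ^+ _).
have hk2 : ((2 * k).+1 < (2 * r.+1).+1)%N by lia.
have := normz_pos_pt false r.+1 _ hk2; rewrite /= oddM /=; move: `|_|%N => e.
have hkr : (k <= r)%N by [].
move: (subnKC hkr); move: (r - k)%N => d <-; nia.
Qed.

(** [theta] has one term more than there are odd k: its last term i = r corresponds to no point of
    the row and accounts for the extra power. *)
Lemma theta_pos_pt1_odd r :
  q ^+ 2 * \sum_(i < r) q ^+ `|OL_fnorm (pos_pt true (r, (2 * val i).+1))|
    + (q ^+ 6) ^+ (r ^ 2)
  = (q ^+ 6) ^+ (r ^ 2 + r) * theta _ (q ^+ 6) (q ^+ 6) r.
Proof.
have Q0 : q ^+ 6 != 0 by rewrite expf_neq0.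
rewrite /theta big_ord_recr /= subnn muln0 !expr0 !mul1r mulrDr; congr (_ + _); last first.
  by rewrite exprD mulfK ?expf_neq0.
rewrite !mulr_sumr; apply: eq_bigr => -[k hk] _ /=.
apply: (mulIf (expf_neq0 k Q0)); rewrite !mulrA divfK ?expf_neq0 //.
rewrite -!exprM -!exprD; congr (_ ^+ _).
have hk2 : ((2 * k).+1 < (2 * r).+1)%N by lia.
have := normz_pos_pt true r _ hk2; rewrite /= oddM /=; move: `|_|%N => e.
move: (subnKC (ltnW hk)); move: (r - k)%N => d <-; nia.
Qed.

(** Here the point k = 0, of norm (3r + 2)^2 - 3 r^2 = 6 (r + 1)^2 - 2, is the one left
    unmatched. *)
Lemma theta_pos_pt1_even r :
  q ^+ 2 * \sum_(i < r.+1) q ^+ `|OL_fnorm (pos_pt true (r, 2 * val i)%N)|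
  = (q ^+ 6) ^+ (r ^ 2 + r) * theta_shift _ (q ^+ 6) (q ^+ 6) r
    + (q ^+ 6) ^+ (r.+1 ^ 2).
Proof.
have Q0 : q ^+ 6 != 0 by rewrite expf_neq0.
rewrite big_ord_recl mulrDr addrC; congr (_ + _); last first.
  rewrite -!exprM -exprD; congr (_ ^+ _).
  have := normz_pos_pt true r 0 isT; rewrite /= muln0; move: `|_|%N => e; nia.
case: r => [|r]; first by rewrite big_ord0 /theta_shift !mulr0.
rewrite /theta_shift /theta !mulr_sumr; apply: eq_bigr => -[k hk] _ /=.
apply: (mulIf (expf_neq0 k Q0)); rewrite !mulrA divfK ?expf_neq0 //.
rewrite -!exprM -!exprD; congr (_ ^+ _).
rewrite /bump leq0n add1n.
have hk2 : (2 * k.+1 < (2 * r.+1).+1)%N by lia.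
have := normz_pos_pt true r.+1 _ hk2; rewrite oddM /=; move: `|_|%N => e.
have hkr : (k <= r)%N by [].
move: (subnKC hkr); move: (r - k)%N => d <-; nia.
Qed.

(** The deficit of one row cancels the surplus of the preceding one; what survives is the constant
    of L_8 and a power of q that tends to 0. *)
Lemma theta_pos_pt1 N :
  q ^+ 2 * \sum_(r < N) \sum_(k < (2 * r).+1)
     q ^+ `|OL_fnorm (pos_pt true (val r, val k))|
  = -1 + \sum_(r < N) (q ^+ 6) ^+ (r ^ 2 + r)
      * (theta _ (q ^+ 6) (q ^+ 6) r + theta_shift _ (q ^+ 6) (q ^+ 6) r)
    + (q ^+ 6) ^+ (N ^ 2).
Proof.
elim: N => [|N IH]; first by rewrite !big_ord0 mulr0 addr0 addNr.
rewrite ![\sum_(r < N.+1) _]big_ord_recr /= mulrDr IH.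
rewrite (big_ord_double _ N (fun k => q ^+ `|OL_fnorm (pos_pt true (N, k))|)).
rewrite [q ^+ 2 * (_ + _)]mulrDr theta_pos_pt1_even [_ * (theta _ _ _ _ + _)]mulrDr.
rewrite -theta_pos_pt1_odd; ring.
Qed.
End Exponents.

Lemma cvg_mull (R : realType) (c : Cx R) (u : nat -> Cx R) (l : Cx R) :
  u @ \oo --> l -> (fun n => c * u n) @ \oo --> c * l.
Proof.
have hc : (fun _ : nat => c) @ \oo --> c by exact: cvg_cst.
by move=> h; exact: (cvgM hc h).
Qed.

Lemma cvg_add0 (R : realType) (u v : nat -> Cx R) (l : Cx R) :
  u @ \oo --> l -> v @ \oo --> (0 : Cx R) -> (fun n => u n + v n) @ \oo --> l.
Proof. by move=> hu hv; rewrite -[l]addr0; exact: (cvgD hu hv). Qed.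

Lemma cvg_expr0 (R : realType) (z : Cx R) : cmod z < 1 ->
  (fun n => z ^+ (n ^ 2)) @ \oo --> (0 : Cx R).
Proof.
move=> hz; apply: cmod_cvg0.
have h : (fun n => 1 * cmod z ^+ n) @ \oo --> (0 : R).
  by apply: cvg_geometric; rewrite ger0_norm ?cmod_ge0.
apply: (squeeze_cvgr _ (cvg_cst (0 : R)) h); near=> n.
rewrite cmod_ge0 subr0 cmodX mul1r /= ler_wiXn2l ?cmod_ge0 //; first exact: ltW.
by rewrite expnS expn1; nia.
Unshelve. all: by end_near. Qed.

Section Conclusion.
Variables (R : realType) (q : Cx R).
Hypotheses (q_neq0 : q != 0) (q_lt1 : cmod q < 1).

Let qX_neq0 n : q ^+ n != 0. Proof. by rewrite expf_neq0. Qed.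
Let qX_lt1 n : cmod (q ^+ n.+1) < 1.
Proof. by rewrite cmodX exprn_ilt1 ?cmod_ge0. Qed.

Lemma ideal_series_neg (b : bool) (l : Cx R) :
  (fun N => \sum_(r < N) \sum_(k < r.+1) q ^+ `|OL_fnorm (neg_pt b (val r, val k))|) @ \oo --> l ->
  ideal_series_partial principal_neg 2 (~~ b) q @ \oo --> l.
Proof.
apply: ideal_series_cvg => // [n N hn hb|r k hk|r]; last by lia.
  by apply: ideal_count_neg => //; move: hb; rewrite modn2; case: (odd n) b => -[].
by rewrite modn2 neg_pt_parity.
Qed.

Lemma mod6_eq (b : bool) n : (n %% 6 = if b then 4 else 1)%N <->
  odd n = ~~ b /\ (n %% 3 = 1)%N.
Proof. by case: b; split; lia. Qed.

Lemma ideal_series_pos (b : bool) (l : Cx R) :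
  (fun N => \sum_(r < N) \sum_(k < (2 * r).+1) q ^+ `|OL_fnorm (pos_pt b (val r, val k))|) @ \oo --> l ->
  ideal_series_partial (fun _ => True) 6 (if b then 4 else 1) q @ \oo --> l.
Proof.
apply: (ideal_series_cvg _ _ q_lt1 _ _ _ (pos_pt b) (fun r => (2 * r).+1)) => [n N hn|r k hk|r]; last by lia.
  by move=> /mod6_eq [hb h3]; apply: ideal_count_pos.
by apply/mod6_eq; split; [exact: pos_pt_parity|exact: pos_pt_mod3].
Qed.

Lemma L5_ideals : exists l s : Cx R,
  [/\ L5_partial (q ^+ 2) @ \oo --> l,
      ideal_series_partial principal_neg 2 0 q @ \oo --> s &
      q ^- 2 * l = 2 * s].
Proof.
have [l [h1 h2]] := L5_cvg R (q ^+ 2) (qX_neq0 2) (qX_lt1 1).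
exists l, (q ^- 2 / 2 * l); split; [exact: h1| |by field; rewrite q_neq0].
apply: (ideal_series_neg true); apply: cvg_eq1 (cvg_mull _ _ _ _ h2) => N.
rewrite mulr_sumr; apply: eq_bigr => r _.
by rewrite -theta_neg_pt1 //; field; rewrite q_neq0.
Qed.

Lemma L6_ideals : exists l s : Cx R,
  [/\ L6_partial (q ^+ 2) @ \oo --> l,
      ideal_series_partial principal_neg 2 1 q @ \oo --> s &
      q ^-1 * l = 2 * s].
Proof.
have [l [h1 h2]] := L6_cvg R (q ^+ 2) (qX_neq0 2) (qX_lt1 1).
exists l, (q ^-1 / 2 * l); split; [exact: h1| |by field; rewrite q_neq0].
apply: (ideal_series_neg false); apply: cvg_eq1 (cvg_mull _ _ _ _ h2) => N.
rewrite mulr_sumr; apply: eq_bigr => r _.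
rewrite -(theta_neg_pt0 _ q q_neq0 r); by field; rewrite q_neq0.
Qed.

Lemma L7_ideals : exists l s : Cx R,
  [/\ L7_partial (q ^+ 6) @ \oo --> l,
      ideal_series_partial (fun _ => True) 6 1 q @ \oo --> s &
      q * l = s].
Proof.
have [l [h1 h2]] := L7_cvg R (q ^+ 6) (qX_neq0 6) (qX_lt1 5).
exists l, (q * l); split; [exact: h1| |by []].
apply: (ideal_series_pos false); apply: cvg_eq1 (cvg_mull _ _ _ _ h2) => N.
by rewrite mulr_sumr; apply: eq_bigr => r _; rewrite theta_pos_pt0.
Qed.

Lemma L8_ideals : exists l s : Cx R,
  [/\ L8_partial (q ^+ 6) @ \oo --> l,
      ideal_series_partial (fun _ => True) 6 4 q @ \oo --> s &
      q ^- 2 * l = s].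
Proof.
have [l [h1 h2]] := L8_cvg R (q ^+ 6) (qX_neq0 6) (qX_lt1 5).
exists l, (q ^- 2 * l); split; [exact: h1| |by []].
have h3 := cvg_add0 _ _ _ _ h2 (cvg_expr0 R (q ^+ 6) (qX_lt1 5)).
apply: (ideal_series_pos true); apply: cvg_eq1 (cvg_mull _ _ _ _ h3) => N.
by rewrite -theta_pos_pt1 // mulKf.
Qed.
End Conclusion.

Theorem theorem1p2 (R : realType) (q : Cx R) (hq0 : q != 0) (hq1 : `|q| < 1) :
  [/\ (exists l s : Cx R,
         [/\ L5_partial (q ^+ 2) @ \oo --> l,
             ideal_series_partial principal_neg 2 0 q @ \oo --> s &
             q ^- 2 * l = 2 * s]),
      (exists l s : Cx R,
         [/\ L6_partial (q ^+ 2) @ \oo --> l,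
             ideal_series_partial principal_neg 2 1 q @ \oo --> s &
             q ^-1 * l = 2 * s]),
      (exists l s : Cx R,
         [/\ L7_partial (q ^+ 6) @ \oo --> l,
             ideal_series_partial (fun _ => True) 6 1 q @ \oo --> s &
             q * l = s]) &
      (exists l s : Cx R,
         [/\ L8_partial (q ^+ 6) @ \oo --> l,
             ideal_series_partial (fun _ => True) 6 4 q @ \oo --> s &
             q ^- 2 * l = s])].
Proof.
have hq : cmod q < 1 by rewrite -ltcR -cmodE.
split; [exact: L5_ideals|exact: L6_ideals|exact: L7_ideals|exact: L8_ideals].
Qed.
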